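(* For every partition $\lambda$, \[ G_\lambda(x;\alpha,\beta)=\sum_{T\in \mathrm{MMSVT}(\lambda)}\mathrm{wt}(T). \]
   Context: Let $x=(x_1,x_2,\dots)$, $\alpha=(\alpha_1,\alpha_2,\dots)$, $\beta=(\beta_1,\beta_2,\dots)$ be indeterminates. For $n\ge 1$ write $x_n=(x_1,\dots,x_n)$. For a partition $\lambda$ with at most $n$ parts (padded with zeros to $(\lambda_1,\dots,\lambda_n)$), the refined canonical stable Grothendieck polynomial is \[ G_\lambda(x_n;\alpha,\beta)=\frac{\det\Big(x_j^{\lambda_i+n-i}\dfrac{(1-\beta_1x_j)\cdots(1-\beta_{i-1}x_j)}{(1-\alpha_1x_j)\cdots(1-\alpha_{\lambda_i}x_j)}\Big)_{1\le i,j\le n}}{\prod_{1\le i<j\le n}(x_i-x_j)}, \] with rational functions expanded as formal power series. $G_\lambda(x;\alpha,\beta)$ denotes the formal power series in $x_1,x_2,\dots$ (with coefficients in $\mathbb Z[\alpha,\beta]$) whose specialization $x_i=0$ for all $i>n$ equals $G_\lambda(x_n;\alpha,\beta)$ for every $n\ge \ell(\lambda)$. The Young diagram of $\lambda$ is $\{(i,j):1\le j\le\lambda_i\}$ (row $i$, column $j$). A marked multiset-valued tableau of shape $\lambda$ is a filling $T$ of the cells of $\lambda$ such that: each $T(i,j)$ is a nonempty finite multiset $\{a_1\le\dots\le a_k\}$ of positive integers, in which each $a_t$ with $t\ge 2$ and $a_{t-1}<a_t$ may be marked (other elements are unmarked); $\max T(i,j)\le\min T(i,j+1)$ whenever both cells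 lie in the shape; and $\max T(i,j)<\min T(i+1,j)$ whenever both cells lie in the shape. $\mathrm{MMSVT}(\lambda)$ is the set of these. For such $T$, let $x^{T(i,j)}=\prod_k x_k^{m_k}$ where $m_k$ is the number of occurrences (marked or unmarked) of $k$ in $T(i,j)$, and let $\mathrm{unmarked}(T(i,j))$, $\mathrm{marked}(T(i,j))$ be the numbers of unmarked and marked elements of $T(i,j)$. Then \[ \mathrm{wt}(T)=\prod_{(i,j)}x^{T(i,j)}\,\alpha_j^{\mathrm{unmarked}(T(i,j))-1}(-\beta_i)^{\mathrm{marked}(T(i,j))}. \] *)

(* Defs.v *)
From HB Require Import structures.
From mathcomp Require Import all_boot all_order all_algebra.
From mathcomp Require Import finmap boolp classical_sets functions cardinality
  fsbigop.
From mathcomp Require Import monalg.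

Set Implicit Arguments.
Unset Strict Implicit.
Unset Printing Implicit Defensive.

Import GRing.Theory.

Local Open Scope classical_set_scope.
Local Open Scope ring_scope.

(* Everything is indexed from 0: the natural number k stands for the index
   k + 1 of x, alpha, beta, of the rows and columns of a diagram, and for the
   entry k + 1 of a tableau. *)

Local Notation "1" := (@mone _) : monom_scope.
Local Notation "m * n" := (mmul m n) : monom_scope.
Local Notation "'U_(' i )" := (ucm i) : monom_scope.

(* Formal power series in the infinitely many variables x_0, x_1, ...; no
   condition is put on the support. *)
Notation xmonom := {cmonom nat}.

Record fps (R : nzRingType) : Type := Fps { fcoef :> xmonom -> R }.

HB.instance Definition _ (R : nzRingType) := gen_eqMixin (fps R).
HB.instance Definition _ (R : nzRingType) := gen_choiceMixin (fps R).

Lemma fpsP (R : nzRingType) (f g : fps R) : (forall m, f m = g m) <-> f = g.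
Proof.
split=> [|->//]; case: f g => f [g] /= fg; congr Fps; exact: funext.
Qed.

Definition mdvd (d m : xmonom) : Prop := exists e, (d * e)%M = m.

Lemma mdvd_trans d e m : mdvd d e -> mdvd e m -> mdvd d m.
Proof. by move=> [a <-] [b <-]; exists (a * b)%M; rewrite mulmA. Qed.

Lemma mdvd_lem (d m : xmonom) : mdvd d m <-> forall i, (d i <= m i)%N.
Proof.
split=> [[e <-] i|h]; first by rewrite cmM leq_addr.
exists (divcm m d); apply/eqP/cmP=> i; rewrite cmM divcmE subnKC //.
Qed.

Lemma mulmI (k m m' : xmonom) : (k * m = k * m')%M -> m = m'.
Proof.
move=> /eqP/cmP h; apply/eqP/cmP=> i; apply/eqP.
by rewrite -(eqn_add2l (k i)) -!cmM (h i).
Qed.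

Lemma finite_mdvd (m : xmonom) : finite_set [set d | mdvd d m].
Proof.
pose D : {fset nat} := finsupp m.
pose F := {ffun D -> 'I_(mdeg m).+1}.
pose h (g : F) : xmonom := mkcmonom [fsfun i : D => nat_of_ord (g i) | 0%N]%fset.
apply: (@sub_finite_set _ _ (h @` [set: F])); last first.
  exact: finite_image (@finite_finset _ _).
move=> d /mdvd_lem dm; exists [ffun i : D => inord (d (val i))] => //.
apply/eqP/cmP => i; rewrite /h cmE fsfun_ffun.
case: insubP => [u _ <- /=|/=].
  rewrite ffunE inordK // ltnS (leq_trans (dm _)) // mdegE.
  by rewrite (big_fsetD1 (val u)) ?fsvalP //= leq_addr.
by rewrite -cmE_eq0 => /eqP m0; have := dm i; rewrite m0 leqn0 => /eqP.
Qed.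

Definition mfactor (m : xmonom) : set (xmonom * xmonom) :=
  [set p | (p.1 * p.2)%M = m].

Lemma finite_mfactor m : finite_set (mfactor m).
Proof.
apply: (@sub_finite_set _ _ ([set d | mdvd d m] `*` [set d | mdvd d m])).
  by move=> [a b] /= <-; split; [exists b|exists a; rewrite mulmC].
by apply: finite_setX; apply: finite_mdvd.
Qed.

(* The single term c * x^k. *)
HB.lock Definition fmono (R : nzRingType) (c : R) (k : xmonom) : fps R :=
  Fps (fun m => c *+ (m == k)).
Arguments fmono {R} c k.

Lemma fmonoE (R : nzRingType) (c : R) k m : fmono c k m = c *+ (m == k).
Proof. by rewrite unlock. Qed.

HB.lock Definition fps_mul (R : nzRingType) (f g : fps R) : fps R :=
  Fps (fun m => \sum_(p \in mfactor m) f p.1 * g p.2).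
Arguments fps_mul {R} f g.

Lemma fps_mulE (R : nzRingType) (f g : fps R) m :
  fps_mul f g m = \sum_(p \in mfactor m) f p.1 * g p.2.
Proof. by rewrite unlock. Qed.

Section FpsRing.
Context (R : nzRingType).
Implicit Types f g h : fps R.

Definition fps_zero : fps R := Fps (fun=> 0).
Definition fps_opp f := Fps (fun m => - f m).
Definition fps_add f g := Fps (fun m => f m + g m).

Fact fps_addA : associative fps_add.
Proof. by move=> f g h; apply/fpsP => m /=; rewrite addrA. Qed.
Fact fps_addC : commutative fps_add.
Proof. by move=> f g; apply/fpsP => m /=; rewrite addrC. Qed.
Fact fps_add0 : left_id fps_zero fps_add.
Proof. by move=> f; apply/fpsP => m /=; rewrite add0r. Qed.
Fact fps_addN : left_inverse fps_zero fps_opp fps_add.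
Proof. by move=> f; apply/fpsP => m /=; rewrite addNr. Qed.

HB.instance Definition _ := GRing.isZmodule.Build (fps R)
  fps_addA fps_addC fps_add0 fps_addN.

Lemma fcoef0 m : (0 : fps R) m = 0. Proof. by []. Qed.
Lemma fcoefD f g m : (f + g) m = f m + g m. Proof. by []. Qed.
Lemma fcoefN f m : (- f) m = - f m. Proof. by []. Qed.
Lemma fcoefB f g m : (f - g) m = f m - g m. Proof. by []. Qed.

Lemma fps_mul_eq f f' g g' m :
    (forall d, mdvd d m -> f d = f' d) -> (forall d, mdvd d m -> g d = g' d) ->
  fps_mul f g m = fps_mul f' g' m.
Proof.
move=> ff' gg'; rewrite !fps_mulE; apply: eq_fsbigr => -[a b]; rewrite inE /mfactor /= => ab.
by rewrite ff' ?gg' //; [exists a; rewrite mulmC|exists b].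
Qed.

Definition fps_of_malg (F : {malg R[xmonom]}) : fps R := Fps (fun m => F@_m).

Lemma fps_of_malgM F G : fps_mul (fps_of_malg F) (fps_of_malg G)
  = fps_of_malg (F * G).
Proof.
apply/fpsP => m; rewrite fps_mulE /=.
pose D : {fset xmonom} := fset_set [set d | mdvd d m].
have inD d : mdvd d m -> d \in D.
  by move=> dm; rewrite in_fset_set ?inE //; apply: finite_mdvd.
rewrite (@mcoeffMlw _ _ (msupp F `|` D)%fset (msupp G `|` D)%fset);
  rewrite ?fsubsetUl //.
pose H (p : xmonom * xmonom) : R := (F@_p.1 * G@_p.2) *+ ((p.1 * p.2)%M == m).
rewrite -[RHS](big_allpairs (F := H)).
rewrite -[RHS](@fsbig_fwiden _ _ _ +%R _ (mfactor m) H).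
- by apply: eq_fsbigr => -[a b]; rewrite inE /H /mfactor /= => ->; rewrite eqxx.
- move=> [a b] /= ab; apply/allpairsP; exists (a, b).
  rewrite !in_fsetU !inD ?orbT //; [by exists a; rewrite mulmC|by exists b].
- by rewrite allpairs_uniq ?fset_uniq // => -[? ?] [? ?].
- by move=> p [_ /= pm]; rewrite /H /preimage /=; case: eqP.
Qed.

Lemma fps_approx f m :
  exists F : {malg R[xmonom]}, forall d, mdvd d m -> f d = fps_of_malg F d.
Proof.
pose D : {fset xmonom} := fset_set [set d | mdvd d m].
exists (\sum_(k <- D) << f k *g k >>) => d dm /=.
have dD : d \in D by rewrite in_fset_set ?inE //; apply: finite_mdvd.
rewrite (big_morph (mcoeff d) (mcoeffD d) (mcoeff0 _)) (big_fsetD1 d) //=.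
rewrite [X in _ = X + _]mcoeffUU.
rewrite [X in _ + X]big1_seq.
  by rewrite addr0.
move=> k /=; rewrite !inE => /andP[kd _].
by rewrite mcoeffU (negPf kd).
Qed.

Fact fps_mulA : associative (@fps_mul R).
Proof.
move=> f g h; apply/fpsP => m.
have [F fF] := fps_approx f m; have [G gG] := fps_approx g m.
have [H hH] := fps_approx h m.
rewrite (@fps_mul_eq _ (fps_of_malg F) _ (fps_of_malg (G * H))) //; last first.
  move=> d dm; rewrite -fps_of_malgM; apply: fps_mul_eq => e ed;
    by [apply: gG; apply: mdvd_trans dm|apply: hH; apply: mdvd_trans dm].
rewrite (@fps_mul_eq (fps_mul f g) (fps_of_malg (F * G)) _ (fps_of_malg H)) //.
  by rewrite !fps_of_malgM mulrA.
move=> d dm; rewrite -fps_of_malgM; apply: fps_mul_eq => e ed;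
  by [apply: fF; apply: mdvd_trans dm|apply: gG; apply: mdvd_trans dm].
Qed.

Fact fps_mulDl : left_distributive (@fps_mul R) +%R.
Proof.
move=> f g h; apply/fpsP => m; rewrite fcoefD !fps_mulE -fsbig_split; last first.
  exact: finite_mfactor.
by apply: eq_fsbigr => p _; rewrite mulrDl.
Qed.

Fact fps_mulDr : right_distributive (@fps_mul R) +%R.
Proof.
move=> f g h; apply/fpsP => m; rewrite fcoefD !fps_mulE -fsbig_split; last first.
  exact: finite_mfactor.
by apply: eq_fsbigr => p _; rewrite mulrDr.
Qed.

Lemma fps_mul_monol c k f m : fps_mul (fmono c k) f (k * m)%M = c * f m.
Proof.
rewrite fps_mulE (@fsbigE _ _ _ _ _ [:: (k, m)]) //=.
- by rewrite big_cons big_nil mem_set //= fmonoE eqxx mulr1n addr0.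
- by move=> p; rewrite /= inE => /eqP ->.
- move=> [a b]; rewrite /mfactor /= => ab; rewrite inE fmonoE.
  case: (eqVneq a k) => [ak|_ _]; last by rewrite mulr0n mul0r.
  move: ab; rewrite ak => /mulmI ->; by rewrite eqxx.
Qed.

Lemma fps_mul_monol0 c k f m : ~ mdvd k m -> fps_mul (fmono c k) f m = 0.
Proof.
move=> km; rewrite fps_mulE fsbig1 // => -[a b]; rewrite /mfactor /= => ab.
rewrite fmonoE; by case: eqP => [ak|_]; [case: km; exists b; rewrite -ak|rewrite mul0r].
Qed.

Definition fps_one : fps R := fmono 1 1%M.

Lemma fps_mul_const c f m : fps_mul (fmono c 1%M) f m = c * f m.
Proof. by rewrite -{1}[m]mul1m fps_mul_monol. Qed.

Fact fps_mul1 : left_id fps_one (@fps_mul R).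
Proof. by move=> f; apply/fpsP => m; rewrite fps_mul_const mul1r. Qed.

Fact fps_mulr1 : right_id fps_one (@fps_mul R).
Proof.
move=> f; apply/fpsP => m; have [F fF] := fps_approx f m.
have -> : fps_one = fps_of_malg 1.
  by apply/fpsP => d; rewrite fmonoE /= mcoeff1.
rewrite (@fps_mul_eq _ (fps_of_malg F) _ (fps_of_malg 1)) // fps_of_malgM mulr1.
by rewrite fF //; exists 1%M; rewrite mulm1.
Qed.

Fact fps_oner_neq0 : fps_one != 0.
Proof.
apply/eqP => /fpsP /(_ 1%M) /eqP.
by rewrite fmonoE eqxx mulr1n oner_eq0.
Qed.

HB.instance Definition _ := GRing.Zmodule_isNzRing.Build (fps R)
  fps_mulA fps_mul1 fps_mulr1 fps_mulDl fps_mulDr fps_oner_neq0.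
End FpsRing.

Section FpsComUnitRing.
Context (R : comNzRingType).
Implicit Types f g : fps R.

Fact fps_mulC : commutative (@GRing.mul (fps R)).
Proof.
move=> f g; apply/fpsP => m.
have [F fF] := fps_approx f m; have [G gG] := fps_approx g m.
rewrite [LHS](@fps_mul_eq _ _ (fps_of_malg F) _ (fps_of_malg G)) //.
rewrite [RHS](@fps_mul_eq _ _ (fps_of_malg G) _ (fps_of_malg F)) //.
by rewrite !fps_of_malgM mulrC.
Qed.

HB.instance Definition _ := GRing.PzRing_hasCommutativeMul.Build (fps R)
  fps_mulC.

(* With this structure f / g is the power series expansion of a fraction whose
   denominator is an invertible power series. *)
Definition fps_unit : {pred fps R} := fun f => `[< exists g, g * f = 1 >].
Definition fps_inv f : fps R :=
  if pselect (exists g, g * f = 1) is left ex then projT1 (cid ex) else f.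

Fact fps_mulVx : {in fps_unit, left_inverse 1 fps_inv *%R}.
Proof.
move=> f /asboolP fu; rewrite /fps_inv; case: pselect => // ex.
exact: projT2 (cid ex).
Qed.

Fact fps_unitPl f g : g * f = 1 -> fps_unit f.
Proof. by move=> gf; apply/asboolP; exists g. Qed.

Fact fps_inv_out : {in [predC fps_unit], fps_inv =1 id}.
Proof.
move=> f /negP fu; rewrite /fps_inv; case: pselect => // ex.
by case: fu; apply/asboolP.
Qed.

HB.instance Definition _ := GRing.ComNzRing_hasMulInverse.Build (fps R)
  fps_mulVx fps_unitPl fps_inv_out.

Definition fvar (i : nat) : fps R := fmono 1 (ucm i).
Definition fconst (c : R) : fps R := fmono c mone.

Lemma fcoef1 m : (1 : fps R) m = (m == mone)%:R. Proof. exact: fmonoE. Qed.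

Lemma fcoefCM c f m : (fconst c * f) m = c * f m.
Proof. exact: fps_mul_const. Qed.

Lemma fcoefXM i f m : (fvar i * f) (U_(i) * m)%M = f m.
Proof. by rewrite [LHS]fps_mul_monol mul1r. Qed.

Lemma fcoefXM0 i f (m : xmonom) : m i = 0%N -> (fvar i * f) m = 0.
Proof.
move=> mi0; apply: fps_mul_monol0 => /mdvd_lem /(_ i).
by rewrite mi0 cmUU.
Qed.

Lemma ucm_divK i (m : xmonom) : (0 < m i)%N -> exists m', m = (U_(i) * m')%M.
Proof.
move=> mi; suff [m' <-] : mdvd U_(i)%M m by exists m'.
by apply/mdvd_lem => j; rewrite cmU; case: eqP => // <-.
Qed.

Lemma unit_1subCX a i : (1 - fconst a * fvar i : fps R) \is a GRing.unit.
Proof.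
pose g : fps R :=
  Fps (fun m : xmonom => if (finsupp m `<=` [fset i])%fset then a ^+ m i else 0).
apply: (@fps_unitPl _ g); rewrite mulrC mulrBl mul1r -mulrA; apply/fpsP => m.
rewrite fcoefB fcoefCM fcoef1.
case: (posnP (m i)) => [mi0|/ucm_divK [m' ->]].
  rewrite fcoefXM0 // mulr0 subr0 /= mi0 expr0.
  case: eqVneq => [->|m1]; first by rewrite mdom1 fsub0set.
  case: ifP => // /fsubsetP sub; case/eqP: m1; apply/eqP/cmP => j.
  rewrite cm1; apply/eqP; rewrite cmE_eq0; apply/negP => jm.
  have := sub _ jm; rewrite inE => /eqP ji.
  by move: jm; rewrite ji -cmE_neq0 mi0.
rewrite fcoefXM /= mdomD mdomU fsubUset fsubset_refl /= cmM cmUU.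
rewrite cmM_eq1 cm1_eq1 /=.
by case: ifP => _; rewrite ?exprS ?mulr0 subrr.
Qed.

Lemma lreg_subX i j : i != j -> GRing.lreg (fvar i - fvar j : fps R).
Proof.
move=> ij; apply/mulrI0_lreg => f; rewrite mulrBl => /fpsP eqf.
apply/fpsP => m; rewrite fcoef0.
have [n] := ubnP (m j); elim: n m => // n IH m; rewrite ltnS => mn.
have : (fvar i * f) (U_(i) * m)%M - (fvar j * f) (U_(i) * m)%M = 0.
  exact: eqf.
rewrite (fcoefXM i f m).
case: (posnP (m j)) => [mj0|/ucm_divK [m' mE]].
  by rewrite (@fcoefXM0 j f) ?subr0 // cmM cmU (negPf ij) mj0.
have -> : (U_(i) * m = U_(j) * (U_(i) * m'))%M by rewrite mE !mulmA [(U_(i) * _)%M]mulmC.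
rewrite (fcoefXM j f) [X in _ - X]IH ?subr0 // cmM cmU (negPf ij) add0n.
by move: mn; rewrite mE cmM cmUU.
Qed.
End FpsComUnitRing.

Section Specialization.
Context (R : nzRingType).

(* Setting x_i = 0 for every i >= n deletes the monomials in which such a
   variable occurs. *)
Definition fps_trunc (n : nat) (f : fps R) : fps R :=
  Fps (fun m => if all (fun i => (i < n)%N) (finsupp m) then f m else 0).

(* Coefficientwise sum of a family of power series. The big operator over a
   classical set is the expected sum when only finitely many of the F t have a
   nonzero coefficient at m, which is the case below: see mmsvt_summable. *)
Definition fps_sum (T : choiceType) (A : set T) (F : T -> fps R) : fps R :=
  Fps (fun m => \sum_(t \in A) F t m).
End Specialization.

(* Z[alpha, beta]: the polynomial ring in the disjoint union of the alphas
   (inl) and the betas (inr). *)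
Notation Zab := {malg int[{cmonom (nat + nat)%type}]}.

Definition alpha (k : nat) : Zab := << (ucm (inl k) : {cmonom (nat + nat)%type}) >>.
Definition beta (k : nat) : Zab := << (ucm (inr k) : {cmonom (nat + nat)%type}) >>.

(* Partitions are listed without zeros, so that the length of la is its size. *)
Definition is_partition (la : seq nat) : bool :=
  sorted geq la && (0%N \notin la).

Definition part (la : seq nat) (i : nat) : nat := nth 0%N la i.

Definition groth_mx (la : seq nat) (n : nat) : 'M[fps Zab]_n :=
  \matrix_(i < n, j < n)
    (fvar Zab j ^+ (part la i + (n - i.+1))
     * (\prod_(k < i) (1 - fconst (beta k) * fvar Zab j)
        / \prod_(k < part la i) (1 - fconst (alpha k) * fvar Zab j))).

Definition vandermonde_prod (n : nat) : fps Zab :=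
  \prod_(i < n) \prod_(j < n | (i < j)%N) (fvar Zab i - fvar Zab j).

Lemma groth_mx_denom_unit (l j : nat) :
  \prod_(k < l) (1 - fconst (alpha k) * fvar Zab j) \is a GRing.unit.
Proof. by apply: rpred_prod => k _; apply: unit_1subCX. Qed.

Lemma vandermonde_prod_lreg n : GRing.lreg (vandermonde_prod n).
Proof.
rewrite /vandermonde_prod; elim/big_ind: _ => [|f g|i _].
- exact: lreg1.
- exact: lregM.
elim/big_ind: _ => [|f g|j ij]; [exact: lreg1|exact: lregM|].
by apply: lreg_subX; rewrite neq_ltn ij.
Qed.

(* g is the quotient of the determinant by the product of the x_i - x_j. The
   product is not invertible as a power series, but it is regular, so that
   there is at most one such g. *)
Definition is_groth_fin (la : seq nat) (n : nat) (g : fps Zab) : Prop :=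
  g * vandermonde_prod n = \det (groth_mx la n).

Lemma is_groth_fin_inj la n g g' :
  is_groth_fin la n g -> is_groth_fin la n g' -> g = g'.
Proof.
rewrite /is_groth_fin => <- /eqP; rewrite eq_sym => /eqP gg'.
by apply: (@vandermonde_prod_lreg n); rewrite mulrC gg' mulrC.
Qed.

Definition is_groth (la : seq nat) (G : fps Zab) : Prop :=
  forall n, (0 < n)%N -> (size la <= n)%N -> is_groth_fin la n (fps_trunc n G).

(* A finite multiset with marked elements is listed in weakly increasing order;
   the boolean tells whether the element is marked. Since only the first
   occurrence of a value may be marked, the list is determined by the marked
   multiset. *)
Notation mmset := (seq (nat * bool)).

Definition is_mmset (s : mmset) : bool :=
  if s is a :: s' then
    ~~ a.2 && path (fun b c => if c.2 then b.1 < c.1 else b.1 <= c.1)%N a s'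
  else false.

Definition mmin (s : mmset) : nat := (head (0%N, false) s).1.
Definition mmax (s : mmset) : nat := (last (0%N, false) s).1.
Definition marked (s : mmset) : nat := count (fun a => a.2) s.
Definition unmarked (s : mmset) : nat := count (fun a => ~~ a.2) s.

(* The list of the rows of the tableau. *)
Notation tableau := (seq (seq mmset)).

Definition cell (T : tableau) (i j : nat) : mmset := nth [::] (nth [::] T i) j.

Definition MMSVT (la : seq nat) : set tableau :=
  [set T | [/\ shape T = la,
     forall i j, (j < part la i)%N -> is_mmset (cell T i j),
     forall i j, (j.+1 < part la i)%N ->
       (mmax (cell T i j) <= mmin (cell T i j.+1))%N &
     forall i j, (j < part la i)%N -> (j < part la i.+1)%N ->
       (mmax (cell T i j) < mmin (cell T i.+1 j))%N]].

Definition wt (T : tableau) : fps Zab :=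
  \prod_(i < size T) \prod_(j < size (nth [::] T i))
    ((\prod_(a <- cell T i j) fvar Zab a.1)
     * fconst (alpha j ^+ (unmarked (cell T i j)).-1
               * (- beta i) ^+ marked (cell T i j))).

Lemma fmonoM (R : comNzRingType) (c d : R) k l :
  fmono c k * fmono d l = fmono (c * d) (k * l)%M.
Proof.
apply/fpsP => m; case: (pselect (mdvd k m)) => [[m' <-]|km].
  have mE : (m' == l) = ((k * m')%M == (k * l)%M).
    by apply/eqP/eqP => [-> //|/mulmI].
  by rewrite [LHS]fps_mul_monol !fmonoE -mE mulrnAr.
rewrite [LHS]fps_mul_monol0 // fmonoE; case: eqP => // mE.
by case: km; exists l.
Qed.

Definition xexp (T : tableau) : xmonom :=
  \big[mmul/mone]_(i < size T) \big[mmul/mone]_(j < size (nth [::] T i))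
    \big[mmul/mone]_(a <- cell T i j) ucm a.1.

Lemma wt_mono T : exists c, wt T = fmono c (xexp T).
Proof.
pose P (f : fps Zab) (k : xmonom) := exists c, f = fmono c k.
have P1 : P 1 mone by exists 1.
have PM f g k l : P f k -> P g l -> P (f * g) (mmul k l).
  by move=> [c ->] [d ->]; exists (c * d); rewrite fmonoM.
rewrite /wt /xexp; elim/big_ind2: _ => [|? ? ? ?|i _]; [exact: P1|exact: PM|].
elim/big_ind2: _ => [|? ? ? ?|j _]; [exact: P1|exact: PM|].
rewrite -[\big[mmul/mone]_(a <- _) _]mulm1.
apply: (PM); last by eexists; reflexivity.
apply: (big_ind2 P) => [||a _]; [exact: P1|by move=> *; apply: PM|by exists 1].
Qed.

Lemma mdvd_bigop (I : finType) (F : I -> xmonom) (i : I) :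
  mdvd (F i) (\big[mmul/mone]_j F j).
Proof.
by rewrite (bigD1 i) //=; exists (\big[mmul/mone]_(j | j != i) F j).
Qed.

Lemma xexp_cell (T : tableau) (r : seq mmset) (s : mmset) : r \in T -> s \in r ->
  mdvd (\big[mmul/mone]_(a <- s) ucm a.1) (xexp T).
Proof.
move=> /(nthP [::]) [i iT <-] /(nthP [::]) [j jr <-].
pose F (i : 'I_(size T)) := \big[mmul/mone]_(j < size (nth [::] T i))
    \big[mmul/mone]_(a <- cell T i j) ucm a.1.
apply: mdvd_trans (mdvd_bigop F (Ordinal iT)).
exact: (mdvd_bigop
  (fun j : 'I_(size (nth [::] T i)) => \big[mmul/mone]_(a <- cell T i j) ucm a.1)
  (Ordinal jr)).
Qed.

Lemma finite_seq_bounded (X : eqType) (A : set X) n : finite_set A ->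
  finite_set [set s : seq X | (size s <= n)%N /\ forall x, x \in s -> A x].
Proof.
move=> finA; elim: n => [|n IH].
  apply: sub_finite_set (finite_set1 [::]) => s [/=].
  by rewrite leqn0 size_eq0 => /eqP ->.
apply: sub_finite_set (_ : finite_set ([set [::]] `|`
  ((fun p => p.1 :: p.2) @` (A `*`
     [set s : seq X | (size s <= n)%N /\ forall x, x \in s -> A x])))).
  move=> [|x s] [/= sn sA]; [by left|right; exists (x, s) => //=].
  split; first by apply: sA; rewrite inE eqxx.
  by split=> // y ys; apply: sA; rewrite inE ys orbT.
rewrite finite_setU; split; first exact: finite_set1.
by apply: finite_image; apply: finite_setX.
Qed.

Lemma mmsvt_summable la m : finite_set [set T | MMSVT la T /\ wt T m != 0].
Proof.
pose L := [set a : nat * bool | a.1 \in finsupp m].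
have finL : finite_set L.
  apply: sub_finite_set (_ : finite_set
    ([set` finsupp m] `*` [set: bool])) => [[a b] //=|].
  by apply: finite_setX; [exact: finite_fset|exact: finite_finset].
have finC := finite_seq_bounded (mdeg m) finL.
have finR := finite_seq_bounded (sumn la) finC.
have finT := finite_seq_bounded (size la) finR.
apply: sub_finite_set finT => T [/= [shT _ _ _]].
have [c ->] := wt_mono T; rewrite fmonoE.
case: (eqVneq m (xexp T)) => [mE _|_]; last by rewrite eqxx.
split=> [|r rT]; first by rewrite -shT size_map.
split=> [|s sr].
  rewrite -shT; apply: leq_trans (_ : sumn [:: size r] <= _)%N.
    by rewrite /= addn0.
  have /perm_to_rem prm := map_f size rT.
  by rewrite (perm_sumn prm) /= addn0 leq_addr.
have := xexp_cell rT sr; rewrite -mE => dv; split.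
  have [e <-] := dv; rewrite mdegM mdeg_prod (leq_trans _ (leq_addr _ _)) //.
  by under eq_bigr do rewrite mdegU; rewrite sum1_size.
move=> a sa; rewrite /L /= -cmE_neq0 -lt0n.
have /mdvd_lem /(_ a.1) := dv; apply: leq_trans.
by rewrite (big_rem a) //= cmM cmUU.
Qed.

(* Main.v *)
(** Delete the entries equal to the largest letter [n] from a tableau of shape
    [lambda].  What is left is a tableau of some shape [mu] with
    [lambda_{i+1} <= mu_i <= lambda_i], and the deleted entries can be put back
    independently in each cell: a cell outside [mu] contains copies of [n] only,
    which contributes a factor [x_n / (1 - alpha_j x_n)]; the last cell of the
    [i]-th row of [mu] may receive copies of [n] if there is no cell of [lambda]
    under it, which contributes [(1 - beta_i x_n) / (1 - alpha_j x_n)]; the other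
    cells of [mu] do not change.

    The determinants satisfy the same recursion on [n].  Subtract from each row
    [i < n], multiplied by [1 - beta_i x_n], the multiple of row [i + 1] that
    makes the entry in the last column vanish.  The other entries then become
    divisible by [x_j - x_n], the quotient being the telescoping sum over [mu_i]
    of the contributions above times the entries of the smaller matrices, and the
    determinant is linear in each row. *)

Require Import Defs.
From HB Require Import structures.
From mathcomp Require Import all_boot all_order all_algebra perm.
From mathcomp Require Import finmap boolp classical_sets functions cardinality
  fsbigop.
From mathcomp Require Import monalg ring zify.

Set Implicit Arguments.
Unset Strict Implicit.
Unset Printing Implicit Defensive.

Import GRing.Theory.

Local Open Scope ring_scope.

(** * Summable families of power series *)

Section HasSum.
Context (R : comNzRingType).
Implicit Types (T U : choiceType) (f g : fps R).

(* Vanishing and equality are required at all the divisors of [m], and not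
   only at [m], because the coefficient of a product at [m] depends on them. *)
Definition has_sum T (A : set T) (F : T -> fps R) (S : fps R) : Prop :=
  forall m, exists s : seq T, [/\ uniq s, forall t, t \in s -> A t,
    forall t, A t -> t \notin s -> forall d, mdvd d m -> F t d = 0 &
    forall d, mdvd d m -> S d = (\sum_(t <- s) F t) d].

Lemma mdvd_refl m : mdvd m m.
Proof. by exists mone; rewrite mulm1. Qed.

Lemma fcoef_sum T (s : seq T) (F : T -> fps R) m :
  (\sum_(t <- s) F t) m = \sum_(t <- s) F t m.
Proof. by elim: s => [|t s IH]; rewrite ?big_nil // !big_cons fcoefD IH. Qed.

Lemma fcoefM_eq f f' g g' m :
    (forall d, mdvd d m -> f d = f' d) -> (forall d, mdvd d m -> g d = g' d) ->
  (f * g) m = (f' * g') m.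
Proof. exact: fps_mul_eq. Qed.

Lemma fcoefM_eq0l f g m : (forall d, mdvd d m -> f d = 0) -> (f * g) m = 0.
Proof. by move=> f0; rewrite (@fcoefM_eq f 0 g g) // mul0r. Qed.

Lemma fcoefM_eq0r f g m : (forall d, mdvd d m -> g d = 0) -> (f * g) m = 0.
Proof. by move=> g0; rewrite mulrC fcoefM_eq0l. Qed.

Lemma fps_sum_has_sum T (A : set T) F S : has_sum A F S -> fps_sum A F = S.
Proof.
move=> AF; apply/fpsP => m /=; have [s [us sA s0 ->]] := AF m; last first.
  exact: mdvd_refl.
rewrite fcoef_sum (@fsbigE _ _ _ _ _ s) //.
- rewrite [RHS]big_seq [LHS]big_seq_cond; apply: eq_bigl => t.
  by case ts: (t \in s) => //=; rewrite mem_set //; exact: sA.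
- by move=> t At ts; exact: s0 ts _ (mdvd_refl m).
Qed.

Lemma has_sum1 T (t : T) F : has_sum [set t]%classic F (F t).
Proof.
move=> m; exists [:: t]; split=> // [u|u ->|d _].
- by rewrite inE => /eqP.
- by rewrite inE eqxx.
- by rewrite big_cons big_nil addr0.
Qed.

Lemma has_sum0 T (F : T -> fps R) : has_sum set0 F 0.
Proof. by move=> m; exists [::]; split=> // d _; rewrite big_nil. Qed.

Lemma has_sumU T (A B : set T) F S S' : (forall t, A t -> B t -> False) ->
  has_sum A F S -> has_sum B F S' -> has_sum (A `|` B)%classic F (S + S').
Proof.
move=> AB hA hB m; have [s [us sA s0 sS]] := hA m.
have [s' [us' sA' s0' sS']] := hB m; exists (s ++ s'); split.
- rewrite cat_uniq us us' andbT; apply/hasPn => t ts'; apply/negP => ts.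
  exact: AB (sA _ ts) (sA' _ ts').
- by move=> t; rewrite mem_cat => /orP[/sA|/sA']; [left|right].
- by move=> t h; rewrite mem_cat negb_or => /andP[? ?] d dm;
    case: h => [At|Bt]; [exact: s0|exact: s0'].
- by move=> d dm; rewrite big_cat !fcoefD sS ?sS'.
Qed.

Lemma has_sum_bigcup T U (r : seq U) (A : U -> set T) F (S : U -> fps R) :
  uniq r -> (forall u v t, A u t -> A v t -> u = v) ->
  (forall u, u \in r -> has_sum (A u) F (S u)) ->
  has_sum [set t | exists2 u, u \in r & A u t]%classic F (\sum_(u <- r) S u).
Proof.
move=> + inj; elim: r => [|u r IH] /=.
  move=> _ _; rewrite big_nil (_ : mkset _ = set0); first exact: has_sum0.
  by rewrite -subset0 => t [].
move=> /andP[ur ur'] h; rewrite big_cons.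
rewrite (_ : mkset _ =
    A u `|` [set t | exists2 u, u \in r & A u t])%classic.
  apply: has_sumU; last by apply: IH => // v vr; apply: h; rewrite inE vr orbT.
    by move=> t ut [v vr vt]; move: ur; rewrite (inj _ _ _ ut vt) vr.
  by apply: h; rewrite inE eqxx.
rewrite eqEsubset; split=> t /=.
  by case=> v; rewrite inE => /orP[/eqP ->|]; [left|right; exists v].
case=> [?|[v vr ?]]; first by exists u; rewrite // inE eqxx.
by exists v => //; rewrite inE vr orbT.
Qed.

Lemma has_sum_bij T U (A : set T) (B : set U) (h : T -> U) F G S :
  (forall t u, A t -> A u -> h t = h u -> t = u) ->
  (forall t, A t -> B (h t)) -> (forall u, B u -> exists2 t, A t & h t = u) ->
  (forall t, A t -> G (h t) = F t) ->
  has_sum A F S -> has_sum B G S.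
Proof.
move=> inj hB surj GF hA m; have [s [us sA s0 sS]] := hA m.
exists (map h s); split.
- by rewrite map_inj_in_uniq // => t u ts us'; apply: inj; exact: sA.
- by move=> u /mapP[t ts ->]; apply/hB/sA.
- move=> u /surj [t At <-] hts d dm; rewrite GF //; apply: s0 => //.
  by apply: contra hts; exact: map_f.
- move=> d dm; rewrite big_map sS //; congr fcoef; apply: eq_big_seq => t ts.
  by rewrite GF //; exact: sA.
Qed.

Lemma has_sumMl T (A : set T) F S f :
  has_sum A F S -> has_sum A (fun t => f * F t) (f * S).
Proof.
move=> hA m; have [s [us sA s0 sS]] := hA m; exists s; split=> //.
  move=> t At ts d dm; apply: fcoefM_eq0r => e ed; apply: s0 => //.
  exact: mdvd_trans dm.
move=> d dm; rewrite -mulr_sumr; apply: fcoefM_eq => // e ed; apply: sS.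
exact: mdvd_trans dm.
Qed.

(** The inner sum [W] is the same over every point of the base, so the double sum factors. In this
    way a letter added to tableaux of a fixed shape multiplies their whole generating series by one
    factor. *)
Lemma has_sum_fib T U (A : set T) (B : T -> set U) F H S W :
  has_sum A F S -> (forall t, A t -> has_sum (B t) (H t) W) ->
  has_sum [set p | A p.1 /\ B p.1 p.2]%classic
    (fun p : T * U => F p.1 * H p.1 p.2) (S * W).
Proof.
move=> hA hB m; have [s [us sA s0 sS]] := hA m.
have sub t : exists q : seq U, A t -> [/\ uniq q, forall u, u \in q -> B t u,
    forall u, B t u -> u \notin q -> forall d, mdvd d m -> H t u d = 0 &
    forall d, mdvd d m -> W d = (\sum_(u <- q) H t u) d].
  case: (pselect (A t)) => [/hB/(_ m)[q hq]|nA]; first by exists q.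
  by exists [::].
have [q hq] := choice sub.
exists [seq (t, u) | t <- s, u <- q t]; split.
- rewrite allpairs_uniq_dep // => [t ts|[t u] [t' u'] _ _ /= [-> ->] //].
  by have [] := hq _ (sA _ ts).
- move=> p /allpairsPdep[t [u [ts uq ->]]] /=; split; first exact: sA.
  by have [_ h _ _] := hq _ (sA _ ts); apply: h.
- move=> [t u] /= [At Bu] tus d dm.
  case: (boolP (t \in s)) => ts; last first.
    by apply: fcoefM_eq0l => e ed; apply: s0 => //; exact: mdvd_trans dm.
  have [_ _ h _] := hq _ At; apply: fcoefM_eq0r => e ed.
  apply: h => //; last exact: mdvd_trans dm.
  apply: contra tus => uq; apply/allpairsPdep; exists t, u; split=> //.
- move=> d dm; rewrite big_allpairs_dep /= (@fcoefM_eq S (\sum_(t <- s) F t) W W) //.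
    rewrite mulr_suml !fcoef_sum; apply: eq_big_seq => t ts.
    rewrite -mulr_sumr; apply: fcoefM_eq => // e ed.
    by have [_ _ _ ->] := hq _ (sA _ ts) => //; exact: mdvd_trans dm.
  by move=> e ed; apply: sS; exact: mdvd_trans dm.
Qed.

(** Distributivity for independent choices at [n] positions, by splitting off the first one. It
    serves for the cells of a row and again for the rows of a tableau. *)
Lemma has_sum_seq T (t0 : T) n (A : nat -> set T) (F : nat -> T -> fps R) S :
  (forall i, (i < n)%N -> has_sum (A i) (F i) (S i)) ->
  has_sum [set s | size s = n /\ forall i, (i < n)%N -> A i (nth t0 s i)]%classic
    (fun s => \prod_(i < n) F i (nth t0 s i)) (\prod_(i < n) S i).
Proof.
elim: n A F S => [|n IH] A F S h.
  rewrite big_ord0 (_ : mkset _ = [set [::]])%classic; last first.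
    by rewrite eqEsubset; split=> [s [/size0nil]|s ->].
  by have := has_sum1 [::] (fun s => \prod_(i < 0) F i (nth t0 s i));
     rewrite /= big_ord0.
rewrite big_ord_recl.
pose A' i := A i.+1; pose F' i := F i.+1; pose S' i := S i.+1.
have h' := IH A' F' S' (fun i => h i.+1).
have := @has_sum_fib _ _ _ (fun=> _) (F 0%N) (fun=> _) (S 0%N) _ (h 0%N isT)
  (fun _ _ => h').
apply: (@has_sum_bij _ _ _ _ (fun p : T * seq T => p.1 :: p.2)).
- by move=> [t s] [t' s'] _ _ [-> ->].
- by move=> [t s] [/= At [sn As]]; split=> /=; [rewrite sn|case].
- move=> [|t s] [//= [sn] As]; exists (t, s) => //; split=> /=.
    exact: (As 0%N).
  by split=> // i; exact: (As i.+1).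
- by move=> [t s] _ /=; rewrite big_ord_recl.
Qed.

Lemma fcoefXn_eq0 (c : R) i k f (m : {cmonom nat}) : (m i < k)%N ->
  ((fconst c * fvar R i) ^+ k * f) m = 0.
Proof.
elim: k m => // k IH m mk; rewrite exprS -!mulrA fcoefCM.
case: (posnP (m i)) => [m0|/ucm_divK [m' mE]]; first by rewrite fcoefXM0 ?mulr0.
rewrite mE fcoefXM IH ?mulr0 //.
by move: mk; rewrite mE cmM cmUU.
Qed.

Lemma has_sum_geom (c : R) i :
  has_sum setT (fun k : nat => (fconst c * fvar R i) ^+ k)
    (1 - fconst c * fvar R i)^-1.
Proof.
set z := fconst c * fvar R i; have uz : 1 - z \is a GRing.unit.
  exact: unit_1subCX.
move=> m; have vanish f k d : (m i < k)%N -> mdvd d m -> (z ^+ k * f) d = 0.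
  move=> mk /mdvd_lem/(_ i) dm; apply: fcoefXn_eq0.
  exact: leq_ltn_trans dm mk.
(* Powers of [z] beyond [m i] vanish at every divisor of [m], and so does the remainder
   [z ^+ (m i).+1 / (1 - z)] of the geometric series. *)
exists (iota 0 (m i).+1); split=> //; first exact: iota_uniq.
  move=> k _; rewrite mem_iota /= add0n -leqNgt => mk d dm.
  by rewrite -[z ^+ k]mulr1 vanish.
move=> d dm; set s := \sum_(_ <- _) _.
have zs : (1 - z) * s = 1 - z ^+ (m i).+1.
  by rewrite -[in RHS](expr1n _ (m i).+1) subrXX /s -[X in iota 0 X]subn0
     -/(index_iota 0 _) big_mkord; congr (_ * _); apply: eq_bigr => k _;
     rewrite expr1n mul1r.
have -> : s = (1 - z)^-1 - z ^+ (m i).+1 * (1 - z)^-1.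
  by apply: (mulrI uz); rewrite zs mulrBr mulrCA divrr // mulr1.
by rewrite fcoefB vanish // subr0.
Qed.

End HasSum.

(** * The recursion for the determinants *)

(** Multilinearity in the rows: [phi] chooses one summand in each row. In the Leibniz formula, every
    product of sums is distributed over these choices. *)
Lemma det_sum_rows (R : comNzRingType) n (K : finType) (P : 'I_n -> pred K)
    (w : 'I_n -> K -> R) (f : 'I_n -> K -> 'I_n -> R) :
  \det (\matrix_(i, j) \sum_(k | P i k) w i k * f i k j) =
  \sum_(phi in family P)
    (\prod_i w i (phi i)) * \det (\matrix_(i, j) f i (phi i) j).
Proof.
under [RHS]eq_bigr do rewrite mulr_sumr.
rewrite exchange_big /=; apply: eq_bigr => s _.
under eq_bigr do rewrite mxE.
rewrite (bigA_distr_big_dep _ (fun i k => w i k * f i k (s i))) mulr_sumr.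
apply: eq_bigr => phi _; rewrite big_split /= mulrCA; congr (_ * (_ * _)).
by apply: eq_bigr => i _; rewrite mxE.
Qed.

(** Shapes are functions on [nat], but the sum over the smaller shapes needs a finite index type;
    the extension by zero passes from one to the other. *)
Definition ffun_nat n K (phi : {ffun 'I_n -> 'I_K}) (i : nat) : nat :=
  if insub i is Some j then phi j else 0%N.

Lemma ffun_natE n K (phi : {ffun 'I_n -> 'I_K}) (i : 'I_n) :
  ffun_nat phi i = phi i.
Proof. by rewrite /ffun_nat valK. Qed.

Lemma ffun_nat_ge n K (phi : {ffun 'I_n -> 'I_K}) i :
  (n <= i)%N -> ffun_nat phi i = 0%N.
Proof. by move=> ni; rewrite /ffun_nat insubF // ltnNge ni. Qed.

Definition interlace n K (l : nat -> nat) : 'I_n -> pred 'I_K :=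
  fun i k => (l i.+1 <= k <= l i)%N.

Section Determinant.
Context (R : comUnitRingType) (a b : nat -> R).
Implicit Types (t y : R).

Definition gen d t : R := t ^+ d / \prod_(k < d) (1 - a k * t).

Definition bprod i t : R := \prod_(k < i) (1 - b k * t).

(** The power of [x j] is split so that the shape [l] enters through [gen] only; the two other
    factors are common to all terms of the sum over smaller shapes. *)
Definition bialt_mx n (l : nat -> nat) (x : nat -> R) : 'M[R]_n :=
  \matrix_(i < n, j < n) (gen (l i) (x j) * x j ^+ (n - i.+1) * bprod i (x j)).

Definition skew_gen d m t : R := \prod_(m <= k < d) (t / (1 - a k * t)).

(* [row_wt i d e m y] is the contribution of [y] in row [i] when this row has
   [d] cells, the next one [e], and [m] cells of the row contain an entry
   smaller than the largest one. *)
Definition row_wt i d e m y : R :=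
  (if (e < m)%N then (1 - b i * y) / (1 - a m.-1 * y) else 1) * skew_gen d m y.

Definition unit_denom t := forall k, 1 - a k * t \is a GRing.unit.

Lemma skew_genS d m t : (m <= d)%N ->
  skew_gen d.+1 m t = skew_gen d m t * (t / (1 - a d * t)).
Proof. by move=> md; rewrite /skew_gen big_nat_recr. Qed.

Lemma genS l t : unit_denom t -> gen l.+1 t = gen l t * (t / (1 - a l * t)).
Proof.
move=> gt; rewrite /gen big_ord_recr /= invrM; last exact: gt.
  by rewrite exprSr; ring.
by apply: rpred_prod => k _; exact: gt.
Qed.

Lemma skew_gen_nil d t : skew_gen d d t = 1.
Proof. by rewrite /skew_gen big_geq. Qed.

Lemma gen_skew d t : unit_denom t -> gen d t = skew_gen d 0 t.
Proof.
move=> gt; elim: d => [|d IH]; last by rewrite genS // IH skew_genS.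
by rewrite /gen /skew_gen big_geq // big_ord0 divr1.
Qed.

Lemma row_wtS i d e m y : (m <= d)%N ->
  row_wt i d.+1 e m y = row_wt i d e m y * (y / (1 - a d * y)).
Proof. by move=> md; rewrite /row_wt skew_genS // [LHS]mulrA. Qed.

Lemma row_wt_last i d e y : (e < d)%N ->
  row_wt i d e d y = (1 - b i * y) / (1 - a d.-1 * y).
Proof. by move=> ed; rewrite /row_wt ed skew_gen_nil mulr1. Qed.

(* Induction on [d - e]; each new term of the sum telescopes. *)
Lemma row_wt_sum i d e t y : (e <= d)%N -> unit_denom t -> unit_denom y ->
  (t - y) * \sum_(e <= m < d.+1) row_wt i d e m y * gen m t =
  t * gen d t * (1 - b i * y) - y * skew_gen d e y * (gen e t * (1 - b i * t)).
Proof.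
move=> /subnK <- gt gy; elim: (d - e)%N => [|k IH].
  rewrite add0n big_nat1 /row_wt ltnn skew_gen_nil; ring.
rewrite addSn; set c := (k + e)%N in IH *; have ec : (e <= c)%N by exact: leq_addl.
rewrite big_nat_recr /=; last by rewrite ltnW // ltnS.
under eq_big_nat => m /andP[_ mc] do rewrite row_wtS // mulrAC.
rewrite -mulr_suml mulrDr mulrA IH row_wt_last ?ltnS //= skew_genS // genS //.
have ut := gt c; have uy := gy c.
set u := 1 - a c * t in ut *; set v := 1 - a c * y in uy *.
have eu : u * u^-1 = 1 by rewrite divrr.
have ev : v * v^-1 = 1 by rewrite divrr.
(* Over the common denominator [u * v] this reads [t - y = t * v - y * u], where the terms with
   [a c] cancel. *)
have key : (t - y) * (t * u^-1) * v^-1 = t * (t * u^-1) - t * (y * v^-1).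
  move: (u^-1) eu (v^-1) ev => u' eu v' ev.
  transitivity (t * (t * u') * (v * v') - t * (y * v') * (u * u')).
    by rewrite /u /v; ring.
  by rewrite eu ev !mulr1.
apply/eqP; rewrite -subr_eq0; apply/eqP.
transitivity (gen c t * (1 - b i * y) *
  ((t - y) * (t * u^-1) * v^-1 - (t * (t * u^-1) - t * (y * v^-1)))); first by ring.
by rewrite key subrr mulr0.
Qed.

(** Bridge from the determinants to the tableaux: the closed form [row_wt] is a product of
    contributions of single cells. *)
Lemma row_wt_prod i d e m y : (m <= d)%N ->
  \prod_(j < d) (if (m <= j)%N then y / (1 - a j * y)
    else if (j.+1 == m) && (e <= j)%N then (1 - b i * y) / (1 - a j * y) else 1) =
  row_wt i d e m y.
Proof.
move=> md; pose F (j : nat) := if (m <= j)%N then y / (1 - a j * y)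
  else if (j.+1 == m) && (e <= j)%N then (1 - b i * y) / (1 - a j * y) else 1.
rewrite -(big_mkord xpredT F) (@big_cat_nat _ _ _ m) //= /row_wt; congr (_ * _).
  case: m @F md => [|m] F md; first by rewrite big_geq.
  rewrite big_nat_recr //= big_nat big1 ?mul1r => [|j /andP[_ jm]].
    by rewrite /F ltnn eqxx.
  by rewrite /F leqNgt ltnS (ltnW jm) eqSS ltn_eqF.
by apply: eq_big_nat => j /andP[mj _]; rewrite /F mj.
Qed.

Lemma row_wt0 i y : row_wt i 0 0 0 y = 1.
Proof. by rewrite /row_wt ltnn skew_gen_nil mulr1. Qed.

Lemma det_scale_cols n (c : 'I_n -> R) (A : 'M[R]_n) :
  \det (\matrix_(i, j) (c j * A i j)) = (\prod_j c j) * \det A.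
Proof.
have -> : \matrix_(i, j) (c j * A i j) = A *m diag_mx (\row_j c j).
  by apply/matrixP => i j; rewrite mul_mx_diag !mxE mulrC.
rewrite det_mulmx det_diag mulrC; congr (_ * _).
by apply: eq_bigr => j _; rewrite mxE.
Qed.

(** * Row operations and the recursion on the number of variables *)

Section Recursion.
Variables (n : nat) (l : nat -> nat) (x : nat -> R).
Hypothesis gx : forall j, unit_denom (x j).
Hypothesis gb : forall j k, 1 - b k * x j \is a GRing.unit.
Hypothesis lS : forall i, (l i.+1 <= l i)%N.

Let y := x n.

Definition elim_mx : 'M[R]_n.+1 :=
  \matrix_(i, j) (((i < n)%N%:R * (1 - b i * y) + (i == n :> nat)%:R) *+ (i == j)
    - (y * skew_gen (l i) (l i.+1) y) *+ (j == i.+1 :> nat)).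

Lemma det_elim_mx : \det elim_mx = bprod n y.
Proof.
(* [elim_mx] is upper triangular, while [det_trig] is about lower triangular matrices. *)
rewrite -det_tr det_trig.
  rewrite big_ord_recr /= !mxE /= !eqxx ltnn ltn_eqF //.
  rewrite mul0r add0r mulr1n mulr0n subr0 mulr1.
  apply: eq_bigr => i _; rewrite !mxE /= ltn_ord eqxx mulr1n.
  by rewrite ![_ == _]ltn_eqF //= addr0 mul1r subr0.
apply/is_trig_mxP => i j ij; rewrite !mxE.
rewrite [j == i]gtn_eqF ?mulr0n // [_ == _.+1]ltn_eqF ?mulr0n ?subr0 //.
by rewrite ltnW // ltnS.
Qed.

Lemma elim_mx_row (A : 'M[R]_n.+1) (i j : 'I_n.+1) (i' : 'I_n.+1) :
    i' = i.+1 :> nat ->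
  (elim_mx *m A) i j =
    (1 - b i * y) * A i j - y * skew_gen (l i) (l i.+1) y * A i' j.
Proof.
move=> i'E; have ii' : i' != i by rewrite -val_eqE /= i'E gtn_eqF.
have iltn : (i < n)%N by rewrite -ltnS -i'E.
rewrite mxE (bigD1 i) //= (bigD1 i') //= big1 ?addr0.
  rewrite !mxE eqxx [i == n :> nat]ltn_eqF // iltn [i == i']eq_sym (negPf ii') i'E eqxx.
  rewrite ltn_eqF // !mulr1n !mulr0n sub0r subr0 addr0 mul1r; ring.
move=> k /andP[ki ki']; rewrite !mxE [i == k]eq_sym (negPf ki) -i'E.
by rewrite (negPf ki' : (k == i' :> nat) = false) !mulr0n subrr mul0r.
Qed.

Lemma elim_mx_last (A : 'M[R]_n.+1) j : (elim_mx *m A) ord_max j = A ord_max j.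
Proof.
rewrite mxE (bigD1 ord_max) //= big1 ?addr0.
  by rewrite !mxE /= ltnn !eqxx ltn_eqF // mul0r add0r mulr1n mulr0n subr0 mul1r.
move=> k kn; rewrite !mxE [ord_max == k]eq_sym (negPf kn) [_ == _.+1]ltn_eqF ?mulr0n.
  by rewrite subrr mul0r.
by rewrite ltn_ord.
Qed.

(** Rows [i] and [i + 1] share the factor [x j ^+ (n - i.+1) * bprod i (x j)]: row [i] has one more
    power of [x j], row [i + 1] one more factor [1 - b i * x j]. What remains is the right-hand side
    of [row_wt_sum]. *)
Lemma bialt_mx_elim (i : 'I_n.+1) (j : 'I_n.+1) : (i < n)%N ->
  (elim_mx *m bialt_mx n.+1 l x) i j =
  (x j - y) * \sum_(l i.+1 <= m < (l i).+1) row_wt i (l i) (l i.+1) m y *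
    (gen m (x j) * x j ^+ (n - i.+1) * bprod i (x j)).
Proof.
move=> ltin; have i'P : (i.+1 < n.+1)%N by [].
rewrite (@elim_mx_row _ i j (Ordinal i'P)) // !mxE /=.
under eq_bigr do rewrite -mulrA mulrA.
rewrite -mulr_suml [RHS]mulrA row_wt_sum ?subSS //; last exact: gx.
rewrite /bprod big_ord_recr /=.
rewrite -(subnSK ltin) exprS; ring.
Qed.

(* In [elim_mx *m bialt_mx] all the entries of the last column vanish, except
   the last one. *)
Lemma det_bialt_rec :
  \det (bialt_mx n.+1 l x) = (\prod_(j < n) (x j - y)) * gen (l n) y *
   \det (\matrix_(i < n, j < n)
     \sum_(l i.+1 <= m < (l i).+1) row_wt i (l i) (l i.+1) m y *
       (gen m (x j) * x j ^+ (n - i.+1) * bprod i (x j))).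
Proof.
have ub : bprod n y \is a GRing.unit by apply: rpred_prod => k _; exact: gb.
(* The determinant [bprod n y] of the row operations is invertible, and it reappears as a factor of
   the last diagonal entry. *)
apply: (mulrI ub); rewrite -{1}det_elim_mx -det_mulmx.
rewrite (expand_det_col _ ord_max) (bigD1 ord_max) //= big1 ?addr0; last first.
  move=> i ni; rewrite bialt_mx_elim ?subrr ?mul0r //.
  by rewrite ltn_neqAle -ltnS ltn_ord andbT.
rewrite elim_mx_last mxE subnn expr0 mulr1 /cofactor -signr_odd oddD addbb.
rewrite expr0 mul1r /=.
set A := row' _ _.
have -> : A = \matrix_(i, j) ((x j - y) * (\matrix_(i < n, j < n)
     \sum_(l i.+1 <= m < (l i).+1) row_wt i (l i) (l i.+1) m y *
       (gen m (x j) * x j ^+ (n - i.+1) * bprod i (x j))) i j).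
  apply/matrixP => i j; rewrite /A mxE mxE bialt_mx_elim lift_max //.
  by rewrite lift_max !mxE.
rewrite det_scale_cols -/y; ring.
Qed.

Lemma det_bialt_branch :
  \det (bialt_mx n.+1 l x) = \sum_(phi : {ffun 'I_n -> 'I_(l 0).+1} |
      phi \in family (interlace l))
    (\prod_(j < n) (x j - y)) *
    (\prod_(i < n.+1) row_wt i (l i) (l i.+1) (ffun_nat phi i) y) *
    \det (bialt_mx n (ffun_nat phi) x).
Proof.
have l0 i : (l i <= l 0)%N.
  by elim: i => // i IH; exact: leq_trans (lS i) IH.
rewrite det_bialt_rec; set A := \matrix_(i, j) _.
have -> : A = \matrix_(i, j) \sum_(k | interlace (K := (l 0).+1) l i k)
    row_wt i (l i) (l i.+1) k y *
      (gen k (x j) * x j ^+ (n - i.+1) * bprod i (x j)).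
  apply/matrixP => i j; rewrite !mxE big_geq_mkord.
  rewrite (@big_ord_widen_cond _ _ _ _ (l 0).+1 (fun k => l i.+1 <= k)%N
    (fun k => row_wt i (l i) (l i.+1) k y *
      (gen k (x j) * x j ^+ (n - i.+1) * bprod i (x j)))) ?ltnS //.
rewrite (@det_sum_rows _ _ _ (interlace l) (fun i k => row_wt i (l i) (l i.+1) k y)
  (fun i k j => gen k (x j) * x j ^+ (n - i.+1) * bprod i (x j))).
rewrite mulr_sumr; apply: eq_bigr => phi _; rewrite mulrA -!(mulrA (\prod_(j < n) _)).
congr (_ * (_ * _)); last first.
  by congr (\det _); apply/matrixP => i j; rewrite !mxE ffun_natE.
rewrite big_ord_recr /= mulrC; congr (_ * _).
  by apply: eq_bigr => i _; rewrite ffun_natE.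
(* The leftover [gen (l n) y] is the weight of row [n], in which the smaller shape has no cell. *)
rewrite ffun_nat_ge // /row_wt ltn0 mul1r; exact: gen_skew (gx n).
Qed.

End Recursion.
End Determinant.

(** * Adding a largest letter to a marked multiset *)

Section Multisets.
Implicit Types (s e : seq (nat * bool)) (n : nat).

(** Convertible to the relation inside [is_mmset]. *)
Definition mle (b c : nat * bool) : bool :=
  if c.2 then (b.1 < c.1)%N else (b.1 <= c.1)%N.

Lemma mle_leq b c : mle b c -> (b.1 <= c.1)%N.
Proof. by rewrite /mle; case: ifP => // _ /ltnW. Qed.

Lemma is_mmset_neq0 s : is_mmset s -> s != [::].
Proof. by case: s. Qed.

Lemma path_mle_mem a s c : path mle a s -> c \in a :: s ->
  (a.1 <= c.1 <= (last a s).1)%N.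
Proof.
elim: s a c => [|b s IH] a c /=; first by rewrite inE => _ /eqP ->; rewrite leqnn.
move=> /andP[/mle_leq ab bs]; rewrite inE => /orP[/eqP ->|cs].
  rewrite leqnn; have /andP[_] := IH _ _ bs (mem_head _ _); exact: leq_trans.
have /andP[bc ->] := IH _ _ bs cs; by rewrite (leq_trans ab).
Qed.

Lemma mmset_mem s c : is_mmset s -> c \in s -> (mmin s <= c.1 <= mmax s)%N.
Proof. by case: s => // a s /andP[_]; exact: path_mle_mem. Qed.

Lemma mmin_in s : is_mmset s -> exists2 c, c \in s & c.1 = mmin s.
Proof. by case: s => // a s _; exists a; rewrite // mem_head. Qed.

Lemma mmax_in s : is_mmset s -> exists2 c, c \in s & c.1 = mmax s.
Proof. by case: s => // a s _; exists (last a s); rewrite // mem_last. Qed.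

Lemma mmin_leq_max s : is_mmset s -> (mmin s <= mmax s)%N.
Proof.
move=> ms; have [c cs cE] := mmin_in ms.
by have /andP[_] := mmset_mem ms cs; rewrite cE.
Qed.

Definition below n s := [seq a <- s | (a.1 < n)%N].

Lemma below_id n s : is_mmset s -> (mmax s < n)%N -> below n s = s.
Proof.
move=> ms sn; apply/all_filterP/allP => c cs.
by have /andP[_ /leq_ltn_trans ->] := mmset_mem ms cs.
Qed.

Lemma below_neq0 n s : is_mmset s -> (below n s != [::]) = (mmin s < n)%N.
Proof.
move=> ms; rewrite -has_filter; apply/hasP/idP => [[c cs]|sn].
  by have /andP[? _] := mmset_mem ms cs; apply: leq_ltn_trans.
by have [c cs cE] := mmin_in ms; exists c; rewrite // cE.
Qed.

Lemma mmin_below n s : is_mmset s -> below n s != [::] ->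
  mmin (below n s) = mmin s.
Proof.
by move=> ms; rewrite below_neq0 //; case: s ms => //= a s _; rewrite /mmin /= => ->.
Qed.

(** Entries increase along the list, so the deletion leaves a prefix, in which every mark keeps its
    predecessor. *)
Lemma mmset_below n s : is_mmset s -> below n s != [::] -> is_mmset (below n s).
Proof.
move=> ms; rewrite below_neq0 //; case: s ms => // a s /andP[ua sa].
rewrite /mmin /= => an; rewrite an /= ua /=.
elim: s a {ua} an sa => //= b s IH a an /andP[ab bs].
case: ifP => bn /=; first by rewrite ab IH.
rewrite -/(below n s) (_ : below n s = [::]) //.
apply/eqP; rewrite -[_ == _]negbK -has_filter; apply/hasPn => c cs.
have /andP[bc _] := path_mle_mem bs (mem_behead (s := b :: s) cs).
by rewrite -leqNgt (leq_trans _ bc) // leqNgt bn.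
Qed.

(** There are [k + 1] copies of [n]; a mark requires a strict increase, so only the first copy may
    carry one. *)
Definition tail n k (m : bool) : seq (nat * bool) := (n, m) :: nseq k (n, false).

Lemma path_mle_nseq n b k : path mle (n, b) (nseq k (n, false)).
Proof. by elim: k b => //= k IH b; rewrite IH /mle /= leqnn. Qed.

Lemma mmset_cat_tail n s k m : is_mmset s -> (mmax s < n)%N ->
  is_mmset (s ++ tail n k m).
Proof.
case: s => //= a s /andP[ua sa]; rewrite /mmax /= => sn.
by rewrite ua cat_path sa /= path_mle_nseq /mle /= sn (ltnW sn) if_same.
Qed.

Lemma mmset_tail n k : is_mmset (tail n k false).
Proof. exact: path_mle_nseq. Qed.

Lemma mem_tail n k m c : c \in tail n k m -> c.1 = n.
Proof. by rewrite inE => /orP[/eqP ->|/nseqP[-> _]]. Qed.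

(** After one [n], entries bounded by [n] cannot increase strictly, hence they equal [n] and are
    unmarked. *)
Lemma path_mle_top n a s : a.1 = n -> path mle a s ->
  (forall c, c \in s -> (c.1 <= n)%N) -> s = nseq (size s) (n, false).
Proof.
elim: s a => //= [[c1 c2]] s IH a an /andP[ac cs] sn.
have c1n : (c1 <= n)%N by apply: (sn (c1, c2)); rewrite mem_head.
have cE : (c1, c2) = (n, false).
  by move: ac; rewrite /mle /= an; case: c2 {cs sn} => h;
    congr pair; lia.
rewrite cE -(IH (c1, c2)) ?cE // => [|c' c's]; first by rewrite -cE.
by apply: sn; rewrite inE c's orbT.
Qed.

Lemma mmset_split n s : is_mmset s -> (forall c, c \in s -> (c.1 <= n)%N) ->
  below n s = s \/ exists m k, s = below n s ++ tail n k m.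
Proof.
case: s => // a s /andP[_]; elim: s a => [|c s IH] a.
  move=> _ sn; have := sn a (mem_head _ _); rewrite /below /=.
  rewrite leq_eqVlt => /orP[/eqP an|->]; last by left.
  by right; exists a.2, 0%N; rewrite an ltnn /tail /= -an; case: (a).
move=> /andP[ac cs] sn; have := sn a (mem_head _ _).
have sn' c' : c' \in c :: s -> (c'.1 <= n)%N.
  by move=> c's; apply: sn; rewrite inE c's orbT.
have bE : below n (a :: c :: s) =
    if (a.1 < n)%N then a :: below n (c :: s) else below n (c :: s) by [].
rewrite bE leq_eqVlt => /orP[/eqP an|->].
  have csE := path_mle_top (s := c :: s) an (introT andP (conj ac cs)) sn'; right.
  exists a.2, (size s).+1; rewrite an ltnn.
  have -> : below n (c :: s) = [::].
    rewrite csE; apply/eqP; rewrite -[_ == _]negbK -has_filter -all_predC.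
    by rewrite all_nseq /= ltnn.
  by rewrite {1}csE /tail -an; case: (a).
case: (IH _ cs sn') => [->|[m [k E]]]; first by left.
by right; exists m, k; rewrite {1}E.
Qed.

(** With no entry below [n], the first copy of [n] is the head of the list, and the head is never
    marked. *)
Lemma mmset_top n s : is_mmset s -> (forall c, c \in s -> (c.1 <= n)%N) ->
  below n s = [::] -> exists k, s = tail n k false.
Proof.
move=> ms sn s0; case: (mmset_split ms sn) => [|[m [k]]]; rewrite s0.
  by move=> s0'; rewrite -s0' in ms.
rewrite /= => sE; exists k; rewrite sE; congr (_ :: _); congr pair.
by move: ms; rewrite sE /= => /andP[/negPf].
Qed.

(* The cells that become [s] when the entries equal to [n] are deleted; [ext]
   tells whether [n] may occur in a cell that contains smaller entries. *)
Definition cell_set n s (ext : bool) : set (seq (nat * bool)) :=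
  if s == [::] then [set e | exists k, e = tail n k false]%classic
  else if ext then
    [set e | e = s \/ exists m k, e = s ++ tail n k m]%classic
  else [set s]%classic.

Lemma below_cell_set n s ext e : (forall c, c \in s -> (c.1 < n)%N) ->
  cell_set n s ext e -> below n e = s.
Proof.
move=> sn; have sE : below n s = s by apply/all_filterP/allP.
have tE k m : below n (tail n k m) = [::].
  apply/eqP; rewrite -[_ == _]negbK -has_filter; apply/hasPn => c.
  by move=> /mem_tail ->; rewrite ltnn.
rewrite /cell_set; case: eqP => [-> [k ->] //|_]; case: ifP => _; last by move=> ->.
by case=> [-> //|[m [k ->]]]; rewrite /below filter_cat -!/(below _ _) tE sE cats0.
Qed.

Lemma mem_cell_set n s ext e c : (forall c, c \in s -> (c.1 < n)%N) ->
  cell_set n s ext e -> c \in e -> (c.1 <= n)%N.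
Proof.
move=> sn; rewrite /cell_set; case: eqP => [_ [k ->] /mem_tail -> //|_].
case: ifP => _; last by move=> -> /sn/ltnW.
case=> [-> /sn/ltnW //|[m [k ->]]]; rewrite mem_cat => /orP[/sn/ltnW//|].
by move=> /mem_tail ->.
Qed.

Lemma mmset_cell_set n s ext e : (forall c, c \in s -> (c.1 < n)%N) ->
  (s != [::] -> is_mmset s) -> cell_set n s ext e -> is_mmset e.
Proof.
rewrite /cell_set; case: eqP => [_ _ _ [k ->]|_ sn /(_ isT) ms].
  exact: mmset_tail.
have [c cs cE] := mmax_in ms; have := sn _ cs; rewrite cE => lt.
case: ifP => _; last by move=> ->.
by case=> [->//|[m [k ->]]]; exact: mmset_cat_tail.
Qed.

End Multisets.

(** * Weights of single cells *)

Lemma fconstM (R : comNzRingType) (c d : R) : fconst (c * d) = fconst c * fconst d.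
Proof. by rewrite /fconst fmonoM mul1m. Qed.

Lemma fconstX (R : comNzRingType) (c : R) k : fconst (c ^+ k) = fconst c ^+ k.
Proof. by elim: k => [|k IH]; rewrite ?expr0 // !exprS fconstM IH. Qed.

Lemma fconstN (R : comNzRingType) (c : R) : fconst (- c) = - fconst c.
Proof. by apply/fpsP => m; rewrite fcoefN !fmonoE mulNrn. Qed.

Section CellWeights.
Context (R : comNzRingType) (al be : nat -> R).
Implicit Types (s e : seq (nat * bool)) (n : nat).

Definition cell_wt i j s : fps R :=
  (\prod_(c <- s) fvar R c.1)
  * fconst (al j ^+ (unmarked s).-1 * (- be i) ^+ marked s).

Definition tail_wt i j e : fps R :=
  (\prod_(c <- e) fvar R c.1)
  * fconst (al j ^+ unmarked e * (- be i) ^+ marked e).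

(* The factor by which the weight of a cell grows when [s] is extended to [e];
   the first unmarked element of a cell carries no [alpha]. *)
Definition ext_wt i j s e : fps R :=
  if s == [::] then cell_wt i j e else tail_wt i j (drop (size s) e).

Lemma cell_wt_nil i j : cell_wt i j [::] = 1.
Proof. by rewrite /cell_wt big_nil mul1r expr0 mulr1. Qed.

(** The head of [s] is unmarked and accounts for the decrement in the exponent of [al j]; all the
    entries of [e] are counted in full. *)
Lemma cell_wt_cat i j s e : is_mmset s ->
  cell_wt i j (s ++ e) = cell_wt i j s * tail_wt i j e.
Proof.
case: s => // a s /andP[ua _]; rewrite /cell_wt /tail_wt big_cat /=.
rewrite /unmarked /marked !count_cat /= ua add1n addSn /= (negPf ua) !add0n.
by rewrite !exprD [X in fconst X]mulrACA [in LHS]fconstM [LHS]mulrACA.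
Qed.

Lemma cell_set_wt n i j s ext e : (s != [::] -> is_mmset s) ->
  cell_set n s ext e -> cell_wt i j e = cell_wt i j s * ext_wt i j s e.
Proof.
rewrite /cell_set /ext_wt; case: eqP => [-> _ _|_ /(_ isT) ms].
  by rewrite cell_wt_nil mul1r.
have nil : cell_wt i j s = cell_wt i j s * tail_wt i j (drop (size s) s).
  by rewrite -cell_wt_cat // drop_size cats0.
case: ifP => _; last by move=> ->.
by case=> [->//|[m [k ->]]]; rewrite drop_size_cat // cell_wt_cat.
Qed.

Section Var.
Variables (n i j : nat).
Let x := fvar R n.
Let z := fconst (al j) * x.

Lemma prod_tail k m : \prod_(c <- tail n k m) fvar R c.1 = x ^+ k.+1.
Proof.
rewrite exprS big_cons /=; congr (_ * _).
by elim: k => [|k IH]; rewrite ?big_nil // big_cons IH exprS.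
Qed.

Lemma cell_wt_tail k : cell_wt i j (tail n k false) = x * z ^+ k.
Proof.
rewrite /cell_wt prod_tail /unmarked /marked /= !count_nseq /= mul1n mul0n.
by rewrite expr0 mulr1 fconstX /z exprMn exprS -mulrA [_ ^+ k * _]mulrC.
Qed.

Lemma tail_wt_tail k m : tail_wt i j (tail n k m) =
  (if m then - fconst (be i) * x else z) * z ^+ k.
Proof.
rewrite /tail_wt prod_tail /unmarked /marked /= !count_nseq /= mul1n mul0n.
case: m; rewrite ?add0n ?add1n /z exprMn exprS.
  rewrite expr1 fconstM fconstX fconstN [fconst _ ^+ k * - _]mulrC mulrACA.
  by rewrite [x * _]mulrC [x ^+ k * _]mulrC.
rewrite expr0 mulr1 fconstX exprS mulrACA.
by rewrite [x * _]mulrC [x ^+ k * _]mulrC.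
Qed.

Definition cell_val (nil ext : bool) : fps R :=
  if nil then x / (1 - z)
  else if ext then (1 - fconst (be i) * x) / (1 - z) else 1.

(** If [s] is nonempty and extensible, adding no [n] gives 1, an unmarked first copy gives
    [z / (1 - z)] and a marked one [- fconst (be i) * x / (1 - z)]; the total is
    [(1 - fconst (be i) * x) / (1 - z)]. *)
Lemma cell_set_has_sum s ext : has_sum (cell_set n s ext) (ext_wt i j s)
  (cell_val (s == [::]) ext).
Proof.
have tail_inj k k' m : tail n k m = tail n k' m -> k = k'.
  by move=> /(congr1 size) /=; rewrite !size_nseq => -[].
rewrite /cell_set /cell_val /ext_wt; case: eqP => s0.
  apply: (has_sum_bij (h := fun k => tail n k false))
    (has_sumMl x (has_sum_geom (al j) n))
    => [k k' _ _|k _|e [k ->]|k _].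
  - exact: tail_inj.
  - by exists k.
  - exact: ex_intro2 I erefl.
  - exact: cell_wt_tail.
have nil_wt : tail_wt i j (drop (size s) s) = 1.
  by rewrite drop_size /tail_wt big_nil mul1r !expr0 mulr1.
have hs : has_sum [set s]%classic (fun e => tail_wt i j (drop (size s) e)) 1.
  by rewrite -nil_wt; exact: (has_sum1 s (fun e => tail_wt i j (drop (size s) e))).
case: ext => //.
have hm m : has_sum [set e | exists k, e = s ++ tail n k m]%classic
    (fun e => tail_wt i j (drop (size s) e))
    ((if m then - fconst (be i) * x else z) / (1 - z)).
  apply: (has_sum_bij (h := fun k => s ++ tail n k m))
    (has_sumMl (if m then - fconst (be i) * x else z)
    (has_sum_geom (al j) n)) => [k k' _ _|k _|e [k ->]|k _].
  - by move=> /eqP; rewrite eqseq_cat // eqxx => /eqP; exact: tail_inj.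
  - by exists k.
  - exact: ex_intro2 I erefl.
  - by rewrite drop_size_cat // tail_wt_tail.
have uz : 1 - z \is a GRing.unit by exact: unit_1subCX.
have -> : (1 - fconst (be i) * x) / (1 - z) =
    1 + (z / (1 - z) + - fconst (be i) * x / (1 - z)).
  transitivity ((1 - z + (z - fconst (be i) * x)) / (1 - z)).
    by rewrite addrA subrK.
  by rewrite [- fconst (be i) * x]mulNr [in LHS]mulrDl divrr // [in LHS]mulrDl.
rewrite (_ : mkset _ = [set s] `|` ([set e | exists k, e = s ++ tail n k false] `|`
   [set e | exists k, e = s ++ tail n k true]))%classic; last first.
  rewrite eqEsubset; split=> e /=.
    by case=> [->|[[] [k ->]]]; [left|right; right; exists k|right; left; exists k].
  by case=> [->|[[k ->]|[k ->]]]; [left|right; exists false, k|right; exists true, k].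
apply: has_sumU => //; last first.
  apply: has_sumU; [|exact: hm false|exact: hm true].
  move=> e [k ->] [k' /eqP]; rewrite eqseq_cat // eqxx => /eqP.
  by case.
move=> e ->; case=> -[k] /(congr1 size); rewrite size_cat /= => /eqP;
  by rewrite -[X in X == _]addn0 eqn_add2l.
Qed.

End Var.
End CellWeights.

(** * Adding a largest letter to a tableau *)

Section Tableaux.
Implicit Types (T : tableau) (l phi : nat -> nat).

Definition shaped N l T : Prop :=
  size T = N /\ forall i, (i < N)%N -> size (nth [::] T i) = l i.

(* Contrary to [MMSVT], rows may be empty, so that deleting entries does not
   change the number [N] of rows. *)
Definition tableaux N l n : set tableau :=
  [set T | [/\ shaped N l T,
     forall i j, (j < l i)%N -> is_mmset (cell T i j),
     forall i j, (j.+1 < l i)%N -> (mmax (cell T i j) <= mmin (cell T i j.+1))%N,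
     forall i j, (j < l i)%N -> (j < l i.+1)%N ->
       (mmax (cell T i j) < mmin (cell T i.+1 j))%N &
     forall i j c, (j < l i)%N -> c \in cell T i j -> (c.1 < n)%N]]%classic.

Lemma shaped_eq N l T T' : shaped N l T -> shaped N l T' ->
  (forall i j, (i < N)%N -> (j < l i)%N -> cell T i j = cell T' i j) -> T = T'.
Proof.
move=> [sT rT] [sT' rT'] e; apply: (@eq_from_nth _ [::]); first by rewrite sT.
move=> i; rewrite sT => iN; apply: (@eq_from_nth _ [::]); first by rewrite rT ?rT'.
by move=> j; rewrite rT // => jl; exact: e.
Qed.

Lemma cell_default N l T i j : shaped N l T -> (l i <= j)%N -> cell T i j = [::].
Proof.
move=> [sT rT] lj; rewrite /cell; case: (ltnP i N) => iN.
  by rewrite [LHS]nth_default // rT.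
by rewrite (_ : nth [::] T i = [::]) ?nth_nil // nth_default // sT.
Qed.

Definition mktableau N l (f : nat -> nat -> seq (nat * bool)) :=
  mkseq (fun i => mkseq (f i) (l i)) N.

Lemma mktableau_shaped N l f : shaped N l (mktableau N l f).
Proof. by split=> [|i iN]; rewrite ?size_mkseq // nth_mkseq // size_mkseq. Qed.

Lemma cell_mktableau N l f i j : (i < N)%N -> (j < l i)%N ->
  cell (mktableau N l f) i j = f i j.
Proof. by move=> iN jl; rewrite /cell !nth_mkseq. Qed.

Section Facts.
Variables (N : nat) (l : nat -> nat) (n : nat) (T : tableau).
Hypothesis lS : forall i, (l i.+1 <= l i)%N.
Hypothesis hT : tableaux N l n.+1 T.

Lemma tableau_leq i j c : (j < l i)%N -> c \in cell T i j -> (c.1 <= n)%N.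
Proof. by case: hT => _ _ _ _ h jl cT; rewrite -ltnS; exact: h jl cT. Qed.

Lemma tableau_mmset i j : (j < l i)%N -> is_mmset (cell T i j).
Proof. by case: hT => _ h _ _ _; exact: h. Qed.

Lemma tableau_mmin_leq i j : (j < l i)%N -> (mmin (cell T i j) <= n)%N.
Proof.
move=> jl; have [c cT <-] := mmin_in (tableau_mmset jl); exact: tableau_leq cT.
Qed.

(** Columns increase strictly. Consequently rows of index at least [n] have no entry below [n],
    which bounds the number of rows left after the deletion. *)
Lemma tableau_row_leq i j : (j < l i)%N -> (i <= mmin (cell T i j))%N.
Proof.
case: hT => _ _ _ col _; elim: i => // i IH jl.
have jl' : (j < l i)%N := leq_trans jl (lS i).
apply: leq_ltn_trans (col _ _ jl' jl); apply: leq_trans (IH jl') _.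
exact: mmin_leq_max (tableau_mmset jl').
Qed.

(** The cell underneath has larger entries, which are at most [n]. *)
Lemma tableau_below_above i j : (j < l i.+1)%N ->
  (mmax (cell T i j) < n)%N.
Proof.
case: hT => _ _ _ col _ jl.
exact: leq_trans (col _ _ (leq_trans jl (lS i)) jl) (tableau_mmin_leq jl).
Qed.

Lemma tableau_below_next i j : (j.+1 < l i)%N -> below n (cell T i j.+1) != [::] ->
  (mmax (cell T i j) < n)%N.
Proof.
case: hT => _ _ row _ _ jl; rewrite below_neq0; last exact: tableau_mmset.
exact: leq_ltn_trans (row _ _ jl).
Qed.

(** This makes the cells that survive the deletion an initial segment of each row. *)
Lemma tableau_below_prev i j k : (j <= k < l i)%N -> below n (cell T i k) != [::] ->
  below n (cell T i j) != [::].
Proof.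
move=> /andP[jk]; elim: k jk => [|k IH]; first by rewrite leqn0 => /eqP ->.
rewrite leq_eqVlt => /orP[/eqP -> //|]; rewrite ltnS => jk kl kT.
apply: IH => //; first exact: ltnW.
have kl' := ltnW kl; rewrite below_neq0; last exact: tableau_mmset.
apply: leq_ltn_trans (tableau_below_next kl kT).
exact: mmin_leq_max (tableau_mmset kl').
Qed.

End Facts.

Section Fiber.
Variables (N : nat) (l phi : nat -> nat) (n : nat).
Hypothesis l0 : forall i, (N <= i)%N -> l i = 0%N.
Hypothesis lphi : forall i, (l i.+1 <= phi i <= l i)%N.

Let phil i : (phi i <= l i)%N. Proof. by case/andP: (lphi i). Qed.
Let lphiS i : (l i.+1 <= phi i)%N. Proof. by case/andP: (lphi i). Qed.
Let lS i : (l i.+1 <= l i)%N. Proof. exact: leq_trans (phil i). Qed.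

Let rowN i j : (j < l i)%N -> (i < N)%N.
Proof. by case: (ltnP i N) => // /l0 ->. Qed.

(* Since rows increase weakly and columns strictly, only the last cell of a row
   of [phi], with no cell of [l] under it, may receive [n]. *)
Definition extensible i j : bool := (j.+1 == phi i) && (l i.+1 <= j)%N.

(* The tableaux of shape [l] and entries at most [n] that become [T'] when the
   entries equal to [n] are deleted. *)
Definition fiber T' : set tableau :=
  [set T | size T = N /\ forall i, (i < N)%N ->
    [set r | size r = l i /\ forall j, (j < l i)%N ->
      cell_set n (cell T' i j) (extensible i j) (nth [::] r j)]
    (nth [::] T i)]%classic.

Lemma fiber_shaped T' T : fiber T' T -> shaped N l T.
Proof. by move=> [sT h]; split=> // i /h[]. Qed.

Lemma fiber_cell T' T i j : fiber T' T -> (j < l i)%N ->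
  cell_set n (cell T' i j) (extensible i j) (cell T i j).
Proof. by move=> [sT h] jl; have [_] := h _ (rowN jl); exact. Qed.

Section Lower.
Variable T' : tableau.
Hypothesis hT' : tableaux N phi n T'.

Let cell0 i j : (phi i <= j)%N -> cell T' i j = [::].
Proof. by case: hT' => sT' _ _ _ _; exact: cell_default sT'. Qed.

Lemma fiber_lt i j c : c \in cell T' i j -> (c.1 < n)%N.
Proof.
case: (ltnP j (phi i)) => [jl|/cell0 -> //].
by case: hT' => _ _ _ _; exact.
Qed.

Lemma fiber_mmset i j : cell T' i j != [::] -> is_mmset (cell T' i j).
Proof.
case: (ltnP j (phi i)) => [jl _|/cell0 -> //].
by case: hT' => _ h _ _ _; exact: h.
Qed.

Lemma fiber_neq0 i j : (cell T' i j == [::]) = (phi i <= j)%N.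
Proof.
case: (ltnP j (phi i)) => [jl|/cell0 -> //]; apply/negbTE.
by apply: is_mmset_neq0; case: hT' => _ h _ _ _; exact: h.
Qed.

Lemma fiber_below T i j : fiber T' T -> (j < l i)%N ->
  below n (cell T i j) = cell T' i j.
Proof. by move=> hT jl; apply: below_cell_set (fiber_cell hT jl); exact: fiber_lt. Qed.

(** Cells of [phi] that are not extensible are unchanged, and cells outside [phi] contain [n] only.
    A cell with a right neighbour in [phi] or with a cell of [l] under it is not extensible; in the
    other row comparisons the right neighbour has minimum [n]. *)
Lemma fiber_tableaux T : fiber T' T -> tableaux N l n.+1 T.
Proof.
move=> hT; have mT i j : (j < l i)%N -> is_mmset (cell T i j).
  move=> jl; apply: mmset_cell_set (fiber_cell hT jl); [exact: fiber_lt|].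
  exact: fiber_mmset.
have leT i j c : (j < l i)%N -> c \in cell T i j -> (c.1 <= n)%N.
  by move=> jl; apply: mem_cell_set (fiber_cell hT jl); exact: fiber_lt.
have eqT i j : (j < phi i)%N -> ~~ extensible i j -> cell T i j = cell T' i j.
  move=> jphi /negPf ne; have := fiber_cell hT (leq_trans jphi (phil i)).
  by rewrite /cell_set ne fiber_neq0 leqNgt jphi.
have minT i j : (j < phi i)%N -> mmin (cell T i j) = mmin (cell T' i j).
  move=> jphi; have jl := leq_trans jphi (phil i).
  rewrite -(fiber_below hT jl) mmin_below ?mT //.
  by rewrite (fiber_below hT jl) fiber_neq0 -ltnNge.
have minT' i j : (phi i <= j < l i)%N -> mmin (cell T i j) = n.
  move=> /andP[jphi jl]; have := fiber_cell hT jl.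
  by rewrite /cell_set fiber_neq0 jphi => -[k ->].
have maxT' i j : (j < phi i)%N -> (mmax (cell T' i j) < n)%N.
  move=> jphi; have ms : is_mmset (cell T' i j).
    by apply: fiber_mmset; rewrite fiber_neq0 -ltnNge.
  have [c cs <-] := mmax_in ms; exact: fiber_lt cs.
case: hT' => _ _ row col _; split=> //.
- exact: fiber_shaped hT.
- move=> i j jl; case: (ltnP j.+1 (phi i)) => jphi.
    by rewrite minT // eqT ?(ltnW jphi) ?row // /extensible ltn_eqF.
  rewrite (minT' _ _ (introT andP (conj jphi jl))).
  have [c cT <-] := mmax_in (mT _ _ (ltnW jl)); exact: leT (ltnW jl) cT.
- move=> i j jl jl'; have jphi : (j < phi i)%N := leq_trans jl' (lphiS i).
  rewrite (eqT i) //; last by rewrite /extensible (leqNgt _ j) jl' andbF.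
  case: (ltnP j (phi i.+1)) => jphi'; first by rewrite minT // col.
  by rewrite minT' ?maxT' // jphi'.
Qed.

End Lower.

Lemma fiber_inj T1 T2 T : tableaux N phi n T1 -> tableaux N phi n T2 ->
  fiber T1 T -> fiber T2 T -> T1 = T2.
Proof.
move=> h1 h2 f1 f2; case: (h1) (h2) => s1 _ _ _ _ [s2 _ _ _ _].
apply: (shaped_eq s1 s2) => i j _ jphi; have jl := leq_trans jphi (phil i).
by rewrite -(fiber_below h1 f1 jl) (fiber_below h2 f2 jl).
Qed.

Lemma tableaux_fiber T : tableaux N l n.+1 T ->
  (forall i j, (j < l i)%N -> (below n (cell T i j) != [::]) = (j < phi i)%N) ->
  exists2 T', tableaux N phi n T' & fiber T' T.
Proof.
move=> hT hphi; pose T' := mktableau N phi (fun i j => below n (cell T i j)).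
have sT' : shaped N phi T' := mktableau_shaped _ _ _.
have lphi_trans i j : (j < phi i)%N -> (j < l i)%N.
  by move=> jphi; exact: leq_trans (phil i).
have cT' i j : (j < phi i)%N -> cell T' i j = below n (cell T i j).
  by move=> jphi; rewrite cell_mktableau // (rowN (lphi_trans _ _ jphi)).
have neq0 i j : (j < phi i)%N -> below n (cell T i j) != [::].
  by move=> jphi; rewrite hphi // lphi_trans.
have mT i j : (j < l i)%N -> is_mmset (cell T i j).
  by move=> jl; case: hT => _ h _ _ _; exact: h.
(* A cell of [phi] that is not extensible has a cell of [phi] to its right or a cell of [l] under
   it; either one forces its entries below [n]. *)
have eqT i j : (j < phi i)%N -> ~~ extensible i j ->
    below n (cell T i j) = cell T i j.
  move=> jphi; have jl := lphi_trans _ _ jphi; rewrite negb_and -ltnNge => h.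
  apply: below_id; first exact: mT.
  case/orP: h => [nj|jl']; last exact: (tableau_below_above lS hT jl').
  have jphi' : (j.+1 < phi i)%N by rewrite ltn_neqAle nj.
  by apply: (tableau_below_next hT _ (neq0 _ _ jphi')); exact: lphi_trans.
exists T'.
  split=> //.
  - by move=> i j jphi; rewrite cT' // mmset_below ?neq0 // mT // lphi_trans.
  - move=> i j jphi; have jphi' := ltnW jphi; rewrite !cT' // eqT //; last first.
      by rewrite /extensible ltn_eqF.
    rewrite mmin_below ?neq0 ?mT ?lphi_trans //.
    by case: hT => _ _ row _ _; rewrite row // lphi_trans.
  - move=> i j jphi jphi'; rewrite !cT' // eqT //; last first.
      by rewrite /extensible (leqNgt _ j) (lphi_trans _ _ jphi') andbF.
    rewrite mmin_below ?neq0 ?mT ?lphi_trans //.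
    by case: hT => _ _ _ col _; rewrite col // lphi_trans.
  - by move=> i j c jphi; rewrite cT' // mem_filter => /andP[].
case: (hT) => -[sT rT] _ _ _ _; split=> // i iN; split; first exact: rT.
move=> j jl; rewrite -/(cell T i j) /cell_set.
case: (ltnP j (phi i)) => jphi; last first.
  rewrite (cell_default sT') // eqxx; apply: mmset_top; first exact: mT.
    by move=> c cT; exact: (tableau_leq hT _ cT).
  by apply/eqP; rewrite -[_ == _]negbK hphi // -leqNgt.
rewrite cT' // (negPf (neq0 _ _ jphi)); case: ifP => [_|/negbT ne].
  have [|->|] := mmset_split (n := n) (mT _ _ jl); [|by left|by right].
  by move=> c cT; exact: (tableau_leq hT _ cT).
by rewrite eqT.
Qed.

End Fiber.
End Tableaux.

(** * The generating series of tableaux with bounded entries *)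

Section TableauSum.
Context (R : comNzRingType) (al be : nat -> R).
Implicit Types (T : tableau) (l : nat -> nat).

Let a k := fconst (al k).
Let b k := fconst (be k).
Let x := fvar R.

(** Convertible to [wt] when [al] and [be] are [alpha] and [beta]. *)
Definition tableau_wt T : fps R :=
  \prod_(i < size T) \prod_(j < size (nth [::] T i)) cell_wt al be i j (cell T i j).

Lemma tableau_wtE N l T : shaped N l T ->
  tableau_wt T = \prod_(i < N) \prod_(j < l i) cell_wt al be i j (cell T i j).
Proof.
case=> sT rT; rewrite /tableau_wt sT; apply: eq_bigr => i _.
by rewrite rT.
Qed.

Lemma tableau_wt_widen N l (phi : nat -> nat) T : (forall i, (phi i <= l i)%N) ->
  shaped N phi T ->
  tableau_wt T = \prod_(i < N) \prod_(j < l i) cell_wt al be i j (cell T i j).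
Proof.
move=> phil sT; rewrite (tableau_wtE sT); apply: eq_bigr => i _.
rewrite (big_ord_widen (l i) (fun j => cell_wt al be i j (cell T i j))) //.
rewrite big_mkcond; apply: eq_bigr => j _; case: ltnP => // jphi.
by rewrite (cell_default sT) // cell_wt_nil.
Qed.

Section Fiber.
Variables (N : nat) (l phi : nat -> nat) (n : nat).
Hypothesis l0 : forall i, (N <= i)%N -> l i = 0%N.
Hypothesis lphi : forall i, (l i.+1 <= phi i <= l i)%N.

Lemma fiber_wt T' T : tableaux N phi n T' -> fiber N l phi n T' T ->
  tableau_wt T = tableau_wt T' *
    \prod_(i < N) \prod_(j < l i) ext_wt al be i j (cell T' i j) (cell T i j).
Proof.
move=> hT' fT; case: (hT') => sT' _ _ _ _.
rewrite (tableau_wtE (fiber_shaped fT)) (tableau_wt_widen (l := l) _ sT'); last first.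
  by move=> i; case/andP: (lphi i).
rewrite -big_split; apply: eq_bigr => i _; rewrite -big_split; apply: eq_bigr => j _.
apply: cell_set_wt (fiber_cell l0 fT (ltn_ord j)) => h.
exact: (fiber_mmset hT' h).
Qed.

(** Rows, and cells within a row, are filled independently. The sum depends on [T'] only through its
    shape [phi], as [has_sum_fib] requires. *)
Lemma fiber_has_sum T' : tableaux N phi n T' ->
  has_sum (fiber N l phi n T')
    (fun T => \prod_(i < N) \prod_(j < l i)
       ext_wt al be i j (cell T' i j) (cell T i j))
    (\prod_(i < N) row_wt a b i (l i) (l i.+1) (phi i) (x n)).
Proof.
move=> hT'; apply: (@has_sum_seq _ _ [::] N
  (fun i => [set r | size r = l i /\ forall j, (j < l i)%N ->
      cell_set n (cell T' i j) (extensible l phi i j) (nth [::] r j)]%classic)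
  (fun i r => \prod_(j < l i) ext_wt al be i j (cell T' i j) (nth [::] r j))
  (fun i => row_wt a b i (l i) (l i.+1) (phi i) (x n))) => i iN.
rewrite -row_wt_prod; last by case/andP: (lphi i).
under eq_bigr => j _ do rewrite -(fiber_neq0 hT').
apply: (@has_sum_seq _ _ [::] (l i)
  (fun j => cell_set n (cell T' i j) (extensible l phi i j))
  (fun j => ext_wt al be i j (cell T' i j))
  (fun j => cell_val al be n i j (cell T' i j == [::]) (extensible l phi i j)))
  => j jl.
exact: cell_set_has_sum.
Qed.

Lemma tableaux_fiber_has_sum S : has_sum (tableaux N phi n) tableau_wt S ->
  has_sum [set T | tableaux N l n.+1 T /\ forall i j, (j < l i)%N ->
      (below n (cell T i j) != [::]) = (j < phi i)%N]%classic tableau_wt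
    (S * \prod_(i < N) row_wt a b i (l i) (l i.+1) (phi i) (x n)).
Proof.
move=> hS; have := has_sum_fib hS fiber_has_sum.
apply: (has_sum_bij (h := snd)) => [[T1 T] [T2 T2'] /= [h1 f1] [h2 f2] e|||].
- by rewrite -e in f2 *; rewrite (fiber_inj l0 lphi h1 h2 f1 f2).
- move=> [T' T] /= [hT' fT]; split; first exact: (fiber_tableaux l0 lphi hT' fT).
  by move=> i j jl; rewrite (fiber_below l0 hT' fT jl) (fiber_neq0 hT') -ltnNge.
- move=> T [hT hphi]; have [T' hT' fT] := tableaux_fiber l0 lphi hT hphi.
  by exists (T', T).
- by move=> [T' T] /= [hT' fT]; exact: fiber_wt.
Qed.

End Fiber.

Lemma tableau_interlace N l n T : (forall i, (l i.+1 <= l i)%N) ->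
  (forall i, (N <= i)%N -> l i = 0%N) -> (forall i, (n.+1 <= i)%N -> l i = 0%N) ->
  tableaux N l n.+1 T ->
  exists2 phi : {ffun 'I_n -> 'I_(l 0).+1}, phi \in family (interlace l) &
    forall i j, (j < l i)%N ->
      (below n (cell T i j) != [::]) = (j < ffun_nat phi i)%N.
Proof.
move=> lS lN ln hT; case: (hT) => -[sT rT] _ _ _ _.
have szT i : size (nth [::] T i) = l i.
  by case: (ltnP i N) => iN; [exact: rT|rewrite nth_default ?sT // lN].
(* The number of surviving cells of row [i]: the position of the first emptied cell, or the full
   length of the row if there is none. *)
pose f i := find (fun s => below n s == [::]) (nth [::] T i).
have fl i : (f i <= l i)%N by rewrite -szT find_size.
have f_nil i : (f i < l i)%N -> below n (cell T i (f i)) = [::].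
  by rewrite -szT -has_find => h; apply/eqP; exact: (nth_find _ h).
have l_le0 i : (l i <= l 0)%N.
  by elim: i => // i; exact: leq_trans (lS i).
have fE i j : (j < l i)%N -> (below n (cell T i j) != [::]) = (j < f i)%N.
  move=> jl; case: (ltnP j (f i)) => jf; first by rewrite /cell (before_find _ jf).
  apply/negbTE/negP => /(tableau_below_prev hT (j := f i)).
  rewrite jf jl => /(_ isT); rewrite f_nil ?eqxx //; exact: leq_ltn_trans jl.
(* A cell with another one under it has all its entries below [n], so it cannot be the emptied cell
   at position [f i]. *)
have lf i : (l i.+1 <= f i)%N.
  rewrite leqNgt; apply/negP => fl'; have fl'' := leq_trans fl' (lS i).
  have := f_nil _ fl''; rewrite below_id.
  - by apply/eqP/is_mmset_neq0; exact: (tableau_mmset hT fl'').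
  - exact: (tableau_mmset hT fl'').
  - exact: (tableau_below_above lS hT fl').
have f0 i : (n <= i)%N -> f i = 0%N.
  move=> ni; apply/eqP; rewrite -leqn0 leqNgt; apply/negP => f_gt0.
  have l_gt0 := leq_trans f_gt0 (fl i).
  have := fE _ _ l_gt0; rewrite f_gt0 below_neq0; last exact: (tableau_mmset hT l_gt0).
  by rewrite ltnNge (leq_trans ni) // (tableau_row_leq lS hT l_gt0).
pose phi : {ffun 'I_n -> 'I_(l 0).+1} := [ffun i : 'I_n => inord (f i)].
have phiE i : ffun_nat phi i = f i.
  case: (ltnP i n) => ni; last by rewrite ffun_nat_ge // f0.
  rewrite (ffun_natE phi (Ordinal ni)) ffunE inordK // ltnS.
  exact: leq_trans (fl i) (l_le0 i).
exists phi; last by move=> i j jl; rewrite phiE fE.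
by apply/familyP => i; rewrite /in_mem /= /interlace -ffun_natE phiE lf fl.
Qed.

Definition vandermonde n : fps R :=
  \prod_(i < n) \prod_(j < n | (i < j)%N) (x i - x j).

Lemma vandermondeS n :
  vandermonde n.+1 = vandermonde n * \prod_(j < n) (x j - x n).
Proof.
rewrite /vandermonde big_ord_recr /= [X in _ * X]big1 ?mulr1; last first.
  by move=> j nj; move: (ltn_ord j); rewrite ltnS leqNgt nj.
rewrite -big_split; apply: eq_bigr => i _.
by rewrite big_mkcond big_ord_recr /= ltn_ord -big_mkcond.
Qed.

(** Reconciles products over the [N] rows of the tableaux with products over the rows of the
    determinant. *)
Lemma prod_ord_eq1 (F : nat -> fps R) m n :
  (forall i, (m <= i)%N -> F i = 1) -> (forall i, (n <= i)%N -> F i = 1) ->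
  \prod_(i < m) F i = \prod_(i < n) F i.
Proof.
wlog mn : m n / (m <= n)%N.
  by case: (leqP m n) => [|/ltnW] h H Fm Fn; [|symmetry]; exact: H.
move=> Fm _; rewrite (big_ord_widen n F mn) big_mkcond; apply: eq_bigr => i _.
by case: ltnP => // /Fm.
Qed.

(** Induction on the number [n] of letters. The tableaux keep [N] rows throughout while the
    determinant shrinks, hence two separate vanishing conditions on [l]. *)
Theorem tableaux_has_sum N n l : (forall i, (l i.+1 <= l i)%N) ->
  (forall i, (N <= i)%N -> l i = 0%N) -> (forall i, (n <= i)%N -> l i = 0%N) ->
  exists2 S, has_sum (tableaux N l n) tableau_wt S &
    S * vandermonde n = \det (bialt_mx a b n l x).
Proof.
elim: n l => [|n IH] l lS lN ln.
  (* Without letters [l] is zero, and the only tableau consists of [N] empty rows. *)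
  have sE : shaped N l (nseq N [::]).
    by split=> [|i iN]; rewrite ?size_nseq // nth_nseq iN ln.
  exists 1; last by rewrite /vandermonde big_ord0 mul1r det_mx00.
  rewrite (_ : tableaux N l 0 = [set nseq N [::]])%classic; last first.
    rewrite eqEsubset; split=> [T [sT _ _ _ _]|T ->].
      by apply: (shaped_eq sT sE) => i j _; rewrite ln.
    by split=> // i j; rewrite ln.
  have -> : 1 = tableau_wt (nseq N [::]).
    by rewrite (tableau_wtE sE) big1 // => i _; rewrite big1 // => -[j]; rewrite ln.
  exact: has_sum1.
have interl (phi : {ffun 'I_n -> 'I_(l 0).+1}) : phi \in family (interlace l) ->
    forall i, (l i.+1 <= ffun_nat phi i <= l i)%N.
  move=> /familyP h i; case: (ltnP i n) => ni.
    by have := h (Ordinal ni); rewrite -[phi _]/(phi (Ordinal ni)) /in_mem /=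
      /interlace -ffun_natE.
  by rewrite ffun_nat_ge // ln.
(* The condition on [phi] stands under the existential so that [choice] yields a function [S]
   defined for all [phi]. *)
have ex (phi : {ffun 'I_n -> 'I_(l 0).+1}) : exists S, phi \in family (interlace l) ->
    has_sum (tableaux N (ffun_nat phi) n) tableau_wt S /\
    S * vandermonde n = \det (bialt_mx a b n (ffun_nat phi) x).
  case: (boolP (phi \in family _)) => [/interl h|_]; last by exists 0.
  have h1 i : (l i.+1 <= ffun_nat phi i)%N by case/andP: (h i).
  have h2 i : (ffun_nat phi i <= l i)%N by case/andP: (h i).
  have h3 i : (N <= i)%N -> ffun_nat phi i = 0%N.
    by move=> /lN li; apply/eqP; rewrite -leqn0 -li.
  have [S hS SE] := IH (ffun_nat phi) (fun i => leq_trans (h2 i.+1) (h1 i))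
     h3 (fun i => @ffun_nat_ge _ _ phi i).
  by exists S.
have [S hS] := choice ex.
exists (\sum_(phi | phi \in family (interlace l)) S phi *
   \prod_(i < N) row_wt a b i (l i) (l i.+1) (ffun_nat phi i) (x n)).
  rewrite -big_filter.
  set r := filter _ _.
  have rP phi : (phi \in r) = (phi \in family (interlace l)).
    by rewrite mem_filter mem_index_enum andbT.
  (* [has_sum_bigcup] asks for disjointness over all [phi]. Keeping [phi \in r] inside the set gives
     [ffun_nat phi i <= l i], on which the disjointness rests. *)
  have -> : tableaux N l n.+1 = [set T | exists2 phi, phi \in r &
     [set T | tableaux N l n.+1 T /\ (phi \in r /\ forall i j, (j < l i)%N ->
      (below n (cell T i j) != [::]) = (j < ffun_nat phi i)%N)] T]%classic.
    rewrite eqEsubset; split=> T; last by case=> phi _ [].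
    move=> hT; have [phi phiF h] := tableau_interlace lS lN ln hT.
    by exists phi; rewrite rP.
  apply: has_sum_bigcup.
  - by rewrite filter_uniq // index_enum_uniq.
  - move=> phi psi T [hT [phir hphi]] [_ [psir hpsi]].
    have cmp i : ffun_nat phi i = ffun_nat psi i.
      have h1 : (ffun_nat phi i <= l i)%N.
        by move: phir; rewrite rP => /interl/(_ i)/andP[].
      have h2 : (ffun_nat psi i <= l i)%N.
        by move: psir; rewrite rP => /interl/(_ i)/andP[].
      apply/eqP; rewrite eqn_leq; apply/andP; split; rewrite leqNgt; apply/negP => h.
        have := hphi i (ffun_nat psi i) (leq_trans h h1).
        by rewrite hpsi ?(leq_trans h h1) // ltnn h.
      have := hphi i (ffun_nat phi i) (leq_trans h h2).
      by rewrite hpsi ?(leq_trans h h2) // ltnn h.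
    by apply/ffunP => i; apply: val_inj; have := cmp i; rewrite !ffun_natE.
  - move=> phi phir; have phiF : phi \in family (interlace l) by rewrite -rP.
    have [h _] := hS _ phiF.
    have := tableaux_fiber_has_sum lN (interl _ phiF) h.
    rewrite (_ : mkset _ = mkset (fun T => tableaux N l n.+1 T /\
       (phi \in r /\ forall i j, (j < l i)%N ->
      (below n (cell T i j) != [::]) = (j < ffun_nat phi i)%N))) //.
    by rewrite eqEsubset; split=> T [? ?]; split=> //; tauto.
have gx j : unit_denom a (x j) by move=> k; exact: unit_1subCX.
have gb j k : 1 - b k * x j \is a GRing.unit by exact: unit_1subCX.
rewrite (det_bialt_branch n gx gb lS) mulr_suml; apply: eq_bigr => phi phiF.
have [_ <-] := hS _ phiF; rewrite vandermondeS.
have -> : \prod_(i < N) row_wt a b i (l i) (l i.+1) (ffun_nat phi i) (x n) =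
    \prod_(i < n.+1) row_wt a b i (l i) (l i.+1) (ffun_nat phi i) (x n).
  have eq1 i : l i = 0%N ->
      row_wt a b i (l i) (l i.+1) (ffun_nat phi i) (x n) = 1.
    move=> li0; have := interl _ phiF i; have := lS i; rewrite li0 !leqn0.
    by move=> /eqP -> /eqP ->; rewrite row_wt0.
  apply: (@prod_ord_eq1 (fun i => row_wt a b i (l i) (l i.+1) (ffun_nat phi i) (x n)))
    => i h; apply: eq1; [exact: lN|exact: ln].
by ring.
Qed.

End TableauSum.

(** * Specialization to finitely many variables *)

Lemma bialt_entryE (R : comUnitRingType) (x p q : R) (d e : nat) :
  x ^+ (d + e) * (p / q) = x ^+ d / q * x ^+ e * p.
Proof. by rewrite exprD; ring. Qed.

Lemma groth_mxE la n : groth_mx la n =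
  bialt_mx (fun k => fconst (alpha k)) (fun k => fconst (beta k)) n (part la)
    (fvar Zab).
Proof. apply/matrixP => i j; rewrite !mxE; exact: bialt_entryE. Qed.

Section Truncation.
Variables (la : seq nat).

Lemma shapeP T : shape T = la <-> shaped (size la) (part la) T.
Proof.
split=> [<-|[sT rT]].
  split=> [|i iT]; rewrite ?size_map // /part (nth_map [::]) //.
  by rewrite size_map in iT.
apply: (@eq_from_nth _ 0%N); first by rewrite size_map.
by move=> i; rewrite size_map => iT; rewrite (nth_map [::]) // rT // -sT.
Qed.

Lemma tableaux_MMSVT n T : tableaux (size la) (part la) n T -> MMSVT la T.
Proof. by case=> /shapeP ? ? ? ? _; split. Qed.

Lemma xexp_ge n T i : tableaux (size la) (part la) n T -> (n <= i)%N ->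
  xexp T i = 0%N.
Proof.
case=> -[sT rT] _ _ _ hT ni; rewrite /xexp.
have M (k k' : {cmonom nat}) : k i = 0%N -> k' i = 0%N -> mmul k k' i = 0%N.
  by rewrite cmM => -> ->.
apply: (big_ind (fun k : {cmonom nat} => k i = 0%N)) => [|//|r _]; first exact: cm1.
apply: (big_ind (fun k : {cmonom nat} => k i = 0%N)) => [|//|j _]; first exact: cm1.
rewrite big_seq; apply: (big_ind (fun k : {cmonom nat} => k i = 0%N))
  => [|//|c cT]; first exact: cm1.
have jl : (j < part la r)%N by rewrite -rT // -sT.
by rewrite cmU ltn_eqF // (leq_trans _ ni) // (hT _ _ _ jl cT).
Qed.

Lemma xexp_gt0 T i j c : MMSVT la T -> (j < part la i)%N -> c \in cell T i j ->
  (0 < xexp T c.1)%N.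
Proof.
case=> /shapeP[sT rT] _ _ _ jl cT.
have iN : (i < size la)%N.
  by case: (ltnP i (size la)) jl => // iN; rewrite /part nth_default.
have rowT : nth [::] T i \in T by rewrite mem_nth ?sT.
have cellT : cell T i j \in nth [::] T i by rewrite mem_nth ?rT.
have /mdvd_lem /(_ c.1) := xexp_cell rowT cellT; apply: leq_trans.
by rewrite (big_rem c) //= cmM cmUU.
Qed.

(** The weight of [T] is a multiple of the monomial [xexp T], whose variables are exactly the
    entries of [T]. *)
Lemma trunc_MMSVT n : fps_trunc n (fps_sum (MMSVT la) wt) =
  fps_sum (tableaux (size la) (part la) n) wt.
Proof.
apply/fpsP => m /=; case: ifP => [/allP mn|/negP mn].
  apply/esym/fsbig_widen; first by move=> T; exact: tableaux_MMSVT.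
  move=> T [hT nT]; rewrite /preimage /=; have [c ->] := wt_mono T.
  rewrite fmonoE; case: eqP => // mE; case: nT.
  have [/shapeP sT ? ? ?] := hT; split=> // i j d jl dT.
  by apply: mn; rewrite mE -cmE_neq0 -lt0n (xexp_gt0 hT jl dT).
rewrite fsbig1 // => T hT; have [c ->] := wt_mono T.
rewrite fmonoE; case: eqP => // mE; case: mn; apply/allP => i.
by rewrite mE -cmE_neq0 ltnNge; apply: contra => ni; rewrite (xexp_ge hT ni).
Qed.

End Truncation.

Lemma MMSVT_is_groth la : is_partition la -> is_groth la (fps_sum (MMSVT la) wt).
Proof.
move=> /andP[la_sorted _] n _ lan; rewrite /is_groth_fin trunc_MMSVT groth_mxE.
have partS i : (part la i.+1 <= part la i)%N.
  rewrite /part; case: (ltnP i.+1 (size la)) => il; last by rewrite nth_default.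
  by move/(sortedP 0%N): la_sorted => /(_ _ il).
have part0 i : (size la <= i)%N -> part la i = 0%N by exact: nth_default.
have [S hS <-] := tableaux_has_sum alpha beta partS part0
  (fun i ni => part0 i (leq_trans lan ni)).
(* [tableau_wt alpha beta] and [vandermonde] are convertible to [wt] and [vandermonde_prod]. *)
by rewrite -(fps_sum_has_sum hS).
Qed.

Lemma trunc_inj (R : nzRingType) N (f g : fps R) :
  (forall n, (N <= n)%N -> fps_trunc n f = fps_trunc n g) -> f = g.
Proof.
move=> fg; apply/fpsP => m.
(* This [n] exceeds the index of every variable of [m], so the truncation keeps the coefficient at
   [m]. *)
pose n := maxn N (\max_(i <- finsupp m) i).+1.
have /fpsP/(_ m) /= := fg n (leq_maxl _ _).
case: allP => // -[] i im; rewrite leq_max; apply/orP; right.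
by rewrite ltnS (big_rem i) //= leq_maxl.
Qed.

Theorem theorem3p2 (la : seq nat) (hla : is_partition la) :
  (exists G, is_groth la G) /\
  (forall G, is_groth la G -> G = fps_sum (MMSVT la) wt).
Proof.
have hS := MMSVT_is_groth hla.
split=> [|G hG]; first by exists (fps_sum (MMSVT la) wt).
(* The maximum with 1 is there for the empty partition, since [is_groth] speaks of positive [n]
   only. *)
apply: (@trunc_inj _ (maxn 1 (size la))) => n; rewrite geq_max => /andP[n1 lan].
exact: is_groth_fin_inj (hG n n1 lan) (hS n n1 lan).
Qed.
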